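(* Let $1\le p<\infty$, $r,s\in\mathbb{N}$ with $s\le 2r$, and let $(G_n)_{n\in\mathbb{N}}$ be a family of linear sampling operators with nodes $X_n=(x_{k,n})_{k=1}^n$ and separation constant $\gamma\in(0,1]$ (see context). Suppose that there are constants $K_1,K_2,K_3,K_4>0$ such that $$K_2\|f\|_{\ell_p(X_n)}\le\|G_n(f)\|_p\le K_1\|f\|_{\ell_p(X_n)}\quad\text{for all } f\in L_p(\mathbb{T}),\ n\in\mathbb{N},$$ $$\|f-G_n(f)\|_p\le K_3n^{-s}\|f^{(s)}\|_p\quad\text{for all } f\in W_p^s(\mathbb{T}),\ n\in\mathbb{N},$$ $$\|(G_{2^\nu}(f)-G_{2^{\nu-1}}(f))^{(s)}\|_p\le K_4\,2^{s\nu}\|G_{2^\nu}(f)-G_{2^{\nu-1}}(f)\|_p\quad\text{for all } f\in L_p(\mathbb{T}),\ \nu\in\mathbb{N}$$ (where it is understood that $G_{2^\nu}(f)-G_{2^{\nu-1}}(f)\in W_p^s(\mathbb{T})$). Then there is a constant $C$ independent of $f$ and $n$ such that for all $f\in L_p(\mathbb{T})$ and $n\in\mathbb{N}$ $$\|f_{\gamma/n,\,r}-f\|_{\ell_p(X_n)}+\omega_s(f,1/n)_p\le C\Big(\|f-G_n(f)\|_p+\frac1{n^s}\sum_{k=0}^{[\log_2n]}2^{sk}\big(\|f-G_{2^k}(f)\|_p+\|f-G_{2^{k-1}}(f)\|_p\big)\Big),$$ where, in the term $k=0$, $G_{1/2}(f):=0$.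
   Context: $\mathbb{T}=[0,1)$. For $1\le p<\infty$, $L_p(\mathbb{T})$ is the space of all 1-periodic measurable functions $f$, finite at every point, with $\|f\|_p=(\int_0^1|f(x)|^p\,dx)^{1/p}<\infty$; functions coinciding almost everywhere are not identified, so $f\in L_p(\mathbb{T})$ is given by its value at each point. For $s\in\mathbb{N}$, $f\in W_p^s(\mathbb{T})$ means that $f$ is 1-periodic, $f^{(s-1)}$ is absolutely continuous and $f^{(s)}\in L_p(\mathbb{T})$. For a set of $n$ points $X_n=(x_{k,n})_{k=1}^n$, $\|f\|_{\ell_p(X_n)}=\big(\frac1n\sum_{k=1}^n|f(x_{k,n})|^p\big)^{1/p}$. $\mathbb{N}=\{1,2,\dots\}$ and $[\cdot]$ denotes the integer part. Modulus of smoothness: for $s\in\mathbb{N}$, $\delta>0$, $\omega_s(f,\delta)_p=\sup_{0<h<\delta}\|\Delta_h^sf\|_p$, where $\Delta_h^sf(x)=\sum_{\nu=0}^s\binom{s}{\nu}(-1)^\nu f(x+(s-\nu)h)$. Generalized Steklov average: for $r\in\mathbb{N}$, $\delta>0$ and integrable $f$, $$f_{\delta,r}(x)=(-1)^{r+1}\binom{2r}{r}^{-1}\frac2\delta\int_{-\delta/2}^{\delta/2}\sum_{\nu=0}^{r-1}(-1)^\nu\binom{2r}{\nu}f\Big(x+\frac{r-\nu}{r}t\Big)dt .$$ Sampling operators: for each $n\in\mathbb{N}$, $G_n(f)(x)=\sum_{k=1}^nf(x_{k,n})\varphi_{k,n}(x)$, where $\varphi_{k,n}\in L_p(\mathbb{T})$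 are fixed 1-periodic functions and the nodes $X_n=(x_{k,n})_{k=1}^n$ satisfy $0\le x_{1,n}<x_{2,n}<\dots<x_{n,n}<1$. It is assumed that $\gamma\in(0,1]$ is such that $\min_{1\le k\le n}(x_{k+1,n}-x_{k,n})\ge\gamma/n$ for all $n\in\mathbb{N}$, where $x_{n+1,n}=1+x_{1,n}$. *)

(* Defs.v *)
From HB Require Import structures.
From mathcomp Require Import all_boot all_order all_algebra.
From mathcomp Require Import all_classical all_reals all_analysis.

Set Implicit Arguments.
Unset Strict Implicit.
Unset Printing Implicit Defensive.

Import Order.TTheory GRing.Theory Num.Theory.
Import numFieldNormedType.Exports.

Local Open Scope ring_scope.
Local Open Scope classical_set_scope.

(* R with the sigma-algebra of Lebesgue measurable sets, on which
   completed_lebesgue_measure is defined; the canonical measurable structure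
   of R itself only has the Borel sets. *)
Definition lebesgueType (R : realType) : measurableType _ :=
  caratheodory_type (wlength (R := R) idfun)^*%mu.

Section spaces.
Context {R : realType}.
Implicit Types (f : R -> R) (p : R).

Local Notation mu := (@completed_lebesgue_measure R).

(* (\int_0^1 |f|^p)^(1/p), for 0 < p *)
Definition pnorm p f : \bar R := Lnorm mu p%:E (EFin \o (f \_ `[0, 1[)%R).

Definition Lp p f : Prop :=
  [/\ periodic f 1,
      measurable_fun [set: lebesgueType R] (f : lebesgueType R -> R)
    & (pnorm p f < +oo)%E].

Definition absolutely_continuous (a b : R) f : Prop :=
  forall eps, 0 < eps -> exists2 delta, 0 < delta &
    forall (m : nat) (u v : 'I_m -> R),
      (forall i, [/\ a <= u i, u i <= v i & v i <= b]) ->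
      trivIset setT (fun i => `]u i, v i[%classic) ->
      \sum_(i < m) (v i - u i) < delta ->
      \sum_(i < m) `|f (v i) - f (u i)| < eps.

(* W_p^s for 0 < s. The derivative f^`(s) is only assumed to exist almost
   everywhere (as a consequence of absolute continuity); the total function
   f^`(s) is 0 at the exceptional points. By periodicity, absolute continuity
   on [0, 1] is absolute continuity on every compact interval. *)
Definition Sobolev p (s : nat) f : Prop :=
  [/\ periodic f 1,
      forall (i : nat) (x : R), (i < s.-1)%N -> derivable f^`(i) x 1,
      absolutely_continuous 0 1 f^`(s.-1)
    & Lp p f^`(s)].

Definition fdiff (s : nat) (h : R) f (x : R) : R :=
  \sum_(nu < s.+1) 'C(s, nu)%:R * (-1) ^+ nu * f (x + (s - nu)%:R * h).

Definition modulus p (s : nat) f (delta : R) : \bar R :=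
  ereal_sup [set pnorm p (fdiff s h f) | h in `]0, delta[].

Definition steklov (r : nat) (delta : R) f (x : R) : R :=
  (-1) ^+ r.+1 * 'C(2 * r, r)%:R^-1 * (2 / delta) *
  \int[mu]_(t in `[- (delta / 2), delta / 2])
    (\sum_(nu < r) (-1) ^+ nu * 'C(2 * r, nu)%:R *
       f (x + (r - nu)%:R / r%:R * t)).

Definition discrete_pnorm p (n : nat) (X : 'I_n -> R) f : R :=
  (n%:R^-1 * \sum_(k < n) `|f (X k)| `^ p) `^ p^-1.

(* The node following X k, with x_{n+1} = 1 + x_1 after the last one. *)
Definition next_node (n : nat) (X : 'I_n -> R) (k : 'I_n) : R :=
  X (ordS k) + (k.+1 == n)%:R.

End spaces.

Section sampling.
Context {R : realType}.
Variables (X : forall n : nat, 'I_n -> R)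
  (phi : forall n : nat, 'I_n -> R -> R).

Definition sampling (n : nat) (f : R -> R) (x : R) : R :=
  \sum_(k < n) f (X k) * phi k x.

(* G_{2^(k-1)}(f), with G_{1/2}(f) = 0. *)
Definition sampling_half (k : nat) (f : R -> R) : R -> R :=
  if k is k'.+1 then sampling (2 ^ k') f else cst 0.

End sampling.

(* Main.v *)
Require Import Defs.
From HB Require Import structures.
From mathcomp Require Import all_boot all_order all_algebra.
From mathcomp Require Import all_classical all_reals all_analysis.
From mathcomp Require Import ring lra zify measurable_realfun.
Import Order.TTheory GRing.Theory Num.Theory.
Import numFieldNormedType.Exports.
Local Open Scope ring_scope.
Local Open Scope classical_set_scope.

(** The idea is to write f as a sum of smooth functions plus a small remainder.
    Let m be the integer part of log_2 n. Telescoping along the powers of 2,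
      f = u + c + \sum_(k < m) g_k,  where  g_k = G_{2^(k+1)} f - G_{2^k} f
    and c is the value of f at the only node of X_1. The Jackson inequality
    for the constant function c has a zero right-hand side, so c = G_1 f
    almost everywhere and |u|_p = |f - G_{2^m} f|_p. The s-th derivative of g_k
    is at most a multiple of 2^(s(k+1)) |g_k|_p by the Bernstein inequality, and
    |g_k|_p is at most |f - G_{2^(k+1)} f|_p + |f - G_{2^k} f|_p. Hence
    everything reduces to three facts about a function g in W^s_p, each with the
    bound C n^-s |g^(s)|_p:
    - its modulus of smoothness at 1/n ([fdiff_sobolev]);
    - the discrete norm of g_delta - g for delta = gamma / n
      ([steklov_sobolev] with [node_norm_le]);
    - the norm of g - G_n g, which is the Jackson inequality itself;
    and to bounds for the remainder u: its modulus of smoothness and the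
    discrete norm of u_delta are at most C |u|_p ([pnorm_fdiff], [steklov_le]).
    The discrete norm of u itself is not controlled by |u|_p, since u is
    arbitrary at the nodes. But u = f - \sum_i w_i with smooth w_i, so that
      G_n u = u - (f - G_n f) + \sum_i (w_i - G_n w_i),
    and the lower Marcinkiewicz-Zygmund inequality for u does the rest
    ([sample_node_bound]).

    The two bounds for smooth g come from one principle: a functional
    \sum_i c_i g(x + a_i) that annihilates the polynomials of degree < s is at
    most a constant times l^(s-1) times the integral of |g^(s)| over a window of
    length l containing the points involved ([functional_bound]). Raised to the
    power p by the Hoelder inequality and summed over windows of bounded
    overlap, this gives the discrete estimates ([window_sum]). The windows around
    the nodes are disjoint because of the separation of the nodes. For the
    modulus of smoothness, the norm over a period is first rewritten as an average over
    the shifts by j / n ([pnorm_le_mean]), which turns it into a sum over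
    equally spaced windows.

    The principle needs the increments of an absolutely continuous function to
    be bounded by the integral of its derivative, where the derivative is known
    to exist only almost everywhere ([abs_cont_increment]). The total variation
    of an absolutely continuous F is again absolutely continuous, so F is a
    difference of two monotone absolutely continuous functions. The
    Lebesgue-Stieltjes measure of each of them is dominated by the Lebesgue
    measure, its Radon-Nikodym derivative v is a density for F, and F' = v
    almost everywhere by the Lebesgue differentiation theorem. *)

(** * Absolute continuity and total variation *)

Section ac.
Context {R : realType}.
Implicit Types (F G : R -> R) (x y : R) (l : seq (R * R)).

(** Precomposing with the retraction of the line onto [0, 1] makes the condition
    on [0, 1] a condition on the whole line. *)
Definition clamp01 x : R := Num.max 0 (Num.min x 1).

Lemma clamp01E x : [\/ x <= 0 /\ clamp01 x = 0,
  0 <= x <= 1 /\ clamp01 x = x | 1 <= x /\ clamp01 x = 1].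
Proof.
rewrite /clamp01; have [x1|/ltW x1] := leP x 1.
  have [x0|/ltW x0] := leP 0 x; last by apply: Or31.
  by apply: Or32; rewrite ?x0.
by rewrite max_r ?ler01//; apply: Or33.
Qed.

Lemma clamp01_bounds x : 0 <= clamp01 x <= 1.
Proof. by case: (clamp01E x) => -[? ->]; lra. Qed.

Lemma clamp01_id x : 0 <= x <= 1 -> clamp01 x = x.
Proof. by move=> ?; case: (clamp01E x) => -[? ->]; lra. Qed.

Lemma le_clamp01 x y : x <= y -> clamp01 x <= clamp01 y.
Proof.
by move=> ?; case: (clamp01E x) => -[? ->]; case: (clamp01E y) => -[? ->]; lra.
Qed.

Lemma clamp01_lip x y : x <= y -> clamp01 y - clamp01 x <= y - x.
Proof.
by move=> ?; case: (clamp01E x) => -[? ->]; case: (clamp01E y) => -[? ->]; lra.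
Qed.

(** Disjointness of open intervals, read off the end points: unlike disjointness
    of sets it is inherited by images under a nondecreasing function. *)
Definition nonoverlap (p q : R * R) := (p.2 <= q.1) || (q.2 <= p.1).

Definition interval_family l :=
  all (fun p => p.1 <= p.2) l && pairwise nonoverlap l.

Definition total_length l := \sum_(p <- l) (p.2 - p.1).

(** Absolute continuity on the line with lists of intervals in place of indexed
    families, since refining a family means inserting into a list. *)
Definition abs_cont F := forall eps, 0 < eps -> exists2 delta, 0 < delta &
  forall l, interval_family l -> total_length l < delta ->
  \sum_(p <- l) `|F p.2 - F p.1| < eps.

Lemma abs_cont_clamp F : absolutely_continuous 0 1 F -> abs_cont (F \o clamp01).
Proof.
move=> acF e /acF[d d0 Fd]; exists d => // l /andP[l1 l2] ld.
pose u (i : 'I_(size l)) := clamp01 (nth (0, 0) l i).1.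
pose v (i : 'I_(size l)) := clamp01 (nth (0, 0) l i).2.
have uv i : u i <= v i.
  by apply: le_clamp01; apply: (all_nthP (0, 0) l1).
have -> : \sum_(p <- l) `|(F \o clamp01) p.2 - (F \o clamp01) p.1| =
    \sum_(i < size l) `|F (v i) - F (u i)|.
  by rewrite (big_nth (0, 0)) big_mkord.
apply: Fd.
- move=> i; split => //.
  + by case/andP : (clamp01_bounds (nth (0, 0) l i).1).
  + by case/andP : (clamp01_bounds (nth (0, 0) l i).2).
- have key (i j : 'I_(size l)) : (i < j)%N -> `]u i, v i[ `&` `]u j, v j[ = set0.
    move=> ij.
    have H : nonoverlap (nth (0, 0) l i) (nth (0, 0) l j).
      by apply: (pairwiseP (0, 0) l2); rewrite ?inE.
    apply/seteqP; split => // z /=; rewrite !in_itv/= => -[/andP[z1 z2] /andP[z3 z4]].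
    case/orP : H => /le_clamp01 H.
    + by have := lt_trans (lt_le_trans z2 H) z3; rewrite ltxx.
    + by have := lt_trans (lt_le_trans z4 H) z1; rewrite ltxx.
  apply/trivIsetP => i j _ _; rewrite neq_ltn => /orP[ij|ij]; first exact: key.
  by rewrite setIC; exact: key.
- apply: le_lt_trans ld; rewrite /total_length (big_nth (0, 0)) big_mkord.
  by apply: ler_sum => i _; apply: clamp01_lip; apply: (all_nthP (0, 0) l1).
Qed.

Fixpoint steps x (s : seq R) : seq (R * R) :=
  if s is y :: s' then (x, y) :: steps y s' else [::].

Lemma variation_steps x y F s :
  variation x y F s = \sum_(p <- steps x s) `|F p.2 - F p.1|.
Proof.
elim: s x => [|z s ih] x; first by rewrite /variation !big_nil.
by rewrite /= big_cons -ih /variation /= big_nat_recl.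
Qed.

Lemma total_length_steps x s : total_length (steps x s) = last x s - x.
Proof.
elim: s x => [|z s ih] x; first by rewrite /total_length big_nil subrr.
rewrite /total_length /= big_cons -/(total_length _) ih/=; ring.
Qed.

Lemma steps_family x s : path <%O x s ->
  [/\ interval_family (steps x s), x <= last x s &
  (forall p, p \in steps x s -> x <= p.1 /\ p.2 <= last x s)].
Proof.
elim: s x => [|z s ih] x //= /andP[xz /ih[/andP[h1 h2] zs h3]].
split.
- apply/andP; split; rewrite /= ?h1 ?h2 ?andbT ?(ltW xz)//.
  by apply/allP => p /h3[zp _]; rewrite /nonoverlap /= zp.
- exact: le_trans (ltW xz) zs.
- move=> p; rewrite inE => /predU1P[->|/h3[zp ps]] //=.
  by split => //; rewrite (le_trans (ltW xz)).
Qed.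

Lemma nonoverlap_sub (p q a : R * R) : nonoverlap p q ->
  p.1 <= a.1 /\ a.2 <= p.2 -> nonoverlap a q.
Proof.
move=> /orP[h|h] [pa ap]; apply/orP; [left|right].
  exact: le_trans h.
exact: le_trans pa.
Qed.

Lemma nonoverlapC p q : nonoverlap p q = nonoverlap q p.
Proof. by rewrite /nonoverlap orbC. Qed.

(** Replacing an interval of a family by the steps of a partition of it keeps
    the intervals nonoverlapping; by [refine_length] it keeps the total length. *)
Lemma refine_family (k l : seq (R * R)) p s :
  itv_partition p.1 p.2 s ->
  interval_family (k ++ p :: l) -> interval_family ((k ++ steps p.1 s) ++ l).
Proof.
move=> [/steps_family[/andP[s1 s2] _ s3] /eqP ps].
rewrite ps in s3.
rewrite /interval_family !all_cat !pairwise_cat /= s1 s2.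
move=> /andP[/and3P[-> _ ->] /and3P[/=]].
rewrite allrel_consr => /andP[kp kl] -> /andP[pl ->] /=.
rewrite !andbT; apply/andP; split.
  rewrite allrel_catl kl/=.
  apply/allrelP => a b /s3 pa bl.
  by apply: (nonoverlap_sub p) => //; exact: (allP pl).
apply/allrelP => a b ak /s3 pb.
rewrite nonoverlapC; apply: (nonoverlap_sub p) => //.
by rewrite nonoverlapC; apply: (allP kp).
Qed.

Lemma refine_length (k l : seq (R * R)) p s :
  itv_partition p.1 p.2 s ->
  total_length ((k ++ steps p.1 s) ++ l) = total_length (k ++ p :: l).
Proof.
move=> [_ /eqP ps].
rewrite /total_length !big_cat big_cons/= -/(total_length (steps _ _)).
by rewrite total_length_steps ps addrA.
Qed.

(** Refining every interval of the family by a nearly optimal partition gives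
    another family of the same total length, to which absolute continuity
    applies; the suprema are taken one interval at a time. *)
Lemma abs_cont_total_variation F : abs_cont F -> forall eps, 0 < eps ->
  exists2 delta, 0 < delta & forall l, interval_family l ->
    total_length l < delta ->
    (\sum_(p <- l) total_variation p.1 p.2 F <= eps%:E)%E.
Proof.
move=> acF e /acF[d d0 Fd]; exists d => //.
(* k collects the intervals that are already refined. *)
suff H l k : interval_family (k ++ l) -> total_length (k ++ l) < d ->
    ((\sum_(p <- k) `|F p.2 - F p.1|)%:E +
      \sum_(p <- l) total_variation p.1 p.2 F <= e%:E)%E.
  move=> l l1 l2; have := H l [::] l1 l2.
  by rewrite big_nil add0e.
elim: l k => [|p l ih] k k1 k2.
  by rewrite big_nil adde0 lee_fin ltW// Fd// -(cats0 k).
have p12 : p.1 <= p.2.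
  by move/andP : k1 => [/allP + _]; apply; rewrite mem_cat inE eqxx orbT.
have {}ih s : itv_partition p.1 p.2 s ->
    ((\sum_(q <- k) `|F q.2 - F q.1| + variation p.1 p.2 F s)%:E +
     \sum_(q <- l) total_variation q.1 q.2 F <= e%:E)%E.
  move=> ps; have := ih (k ++ steps p.1 s).
  rewrite big_cat/= -(variation_steps p.1 p.2); apply; first exact: refine_family.
  by rewrite refine_length.
have B0 : (0 <= \sum_(q <- l) total_variation q.1 q.2 F)%E.
  rewrite big_seq; apply: sume_ge0 => q ql; apply: total_variation_ge0.
  by move/andP : k1 => [/allP + _]; apply; rewrite mem_cat inE ql !orbT.
rewrite big_cons.
move: B0 ih.
case: (\sum_(q <- l) total_variation q.1 q.2 F)%E => [B| |] B0 ih //; last first.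
  have [s ps] : exists s, itv_partition p.1 p.2 s.
    move: p12; rewrite le_eqVlt => /predU1P[->|/itv_partition1 ?]; last first.
      by exists [:: p.2].
    by exists [::]; split.
  by have := ih _ ps.
have : (total_variation p.1 p.2 F <=
    (e - B - \sum_(q <- k) `|F q.2 - F q.1|)%:E)%E.
  apply: ge_ereal_sup => _ [_ [s ps <-] <-].
  by have := ih _ ps; rewrite !lee_fin; lra.
have := total_variation_ge F p12.
case: (total_variation p.1 p.2 F) => [T| |] _ //.
by rewrite !lee_fin => TB; lra.
Qed.

(** On an interval of length delta / 2 the variation is at most 1, and [x, y] is
    covered by finitely many of these. *)
Lemma abs_cont_BV F : abs_cont F -> forall x y, x <= y -> total_variation x y F \is a fin_num.
Proof.
move=> /abs_cont_total_variation /(_ 1 ltr01)[d d0 Fd] x y xy.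
have step z : (total_variation z (z + d / 2) F <= 1)%E.
  have := Fd [:: (z, z + d / 2)].
  rewrite /interval_family/total_length !big_seq1 /=; apply; last lra.
  by rewrite !andbT; lra.
have H n : (total_variation x (x + n%:R * (d / 2)) F < +oo)%E.
  elim: n => [|n ih]; first by rewrite mul0r addr0 total_variationxx ltry.
  have nd : 0 <= n%:R * (d / 2) by rewrite mulr_ge0//; lra.
  rewrite -(natr1 n) mulrDl mul1r addrA.
  rewrite (@total_variationD _ _ _ (x + n%:R * (d / 2)));
    [|lra..].
  rewrite lte_add_pinfty//.
  by apply: le_lt_trans (step _) _; rewrite ltry.
have [n yn] : exists n : nat, y <= x + n%:R * (d / 2).
  exists (Num.bound ((y - x) / (d / 2))).
  rewrite -lerBlDl -ler_pdivrMr; last lra.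
  by apply/ltW/archi_boundP; rewrite divr_ge0//; lra.
rewrite ge0_fin_numE ?total_variation_ge0//.
apply: le_lt_trans (H n).
by rewrite (@total_variationD _ x (x + n%:R * (d / 2)) y)// leeDl//
  total_variation_ge0.
Qed.

Definition tv01 F x := fine (total_variation 0 (clamp01 x) F).

Lemma tv01B F x y : abs_cont F -> x <= y ->
  tv01 F y - tv01 F x = fine (total_variation (clamp01 x) (clamp01 y) F).
Proof.
move=> acF xy; have /andP[x0 _] := clamp01_bounds x.
have cxy := le_clamp01 _ _ xy.
rewrite /tv01 (total_variationD _ x0 cxy) fineD ?abs_cont_BV//.
ring.
Qed.

Lemma tv01_homo F x y : abs_cont F -> x <= y -> tv01 F x <= tv01 F y.
Proof.
move=> acF xy; rewrite -subr_ge0 tv01B// fine_ge0// total_variation_ge0//.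
exact: le_clamp01.
Qed.

Lemma tv01_ge F x y : abs_cont F -> x <= y ->
  `|F (clamp01 y) - F (clamp01 x)| <= tv01 F y - tv01 F x.
Proof.
move=> acF xy; have cxy := le_clamp01 _ _ xy.
rewrite tv01B// -lee_fin fineK ?abs_cont_BV//.
exact: total_variation_ge.
Qed.

(** The increments of the variation function are variations over the clamped
    intervals, which form a family of smaller total length. *)
Lemma abs_cont_tv01 F : abs_cont F -> abs_cont (tv01 F).
Proof.
move=> acF e e0.
have [|d d0 Fd] := abs_cont_total_variation _ acF (e / 2); first lra.
exists d => // l /andP[l1 l2] ld.
pose c := fun p : R * R => (clamp01 p.1, clamp01 p.2).
have := Fd (map c l).
rewrite /interval_family/total_length !big_map all_map pairwise_map.
have -> : all (preim c (fun p => p.1 <= p.2)) l.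
  by apply: sub_all l1 => p /=; exact: le_clamp01.
have -> : pairwise (relpre c nonoverlap) l.
  apply: sub_pairwise l2 => p q /orP[|] /le_clamp01 h; apply/orP;
    by [left|right].
move=> /(_ erefl) /=.
have -> : \sum_(j <- l) (clamp01 j.2 - clamp01 j.1) < d.
  apply: le_lt_trans ld; rewrite /total_length big_seq [leRHS]big_seq.
  by apply: ler_sum => p pl; apply: clamp01_lip; apply: (allP l1).
move=> /(_ erefl) H.
suff : ((\sum_(p <- l) `|tv01 F p.2 - tv01 F p.1|)%:E <= (e / 2)%:E)%E.
  by rewrite lee_fin; lra.
apply: le_trans H; rewrite -sumEFin big_seq [leRHS]big_seq.
apply: lee_sum => p pl; have p12 := allP l1 _ pl.
by rewrite tv01B// ger0_norm ?fine_ge0// ?fineK// ?total_variation_ge0 ?abs_cont_BV//;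
  apply: le_clamp01.
Qed.

End ac.

(** * Densities of monotone absolutely continuous functions *)

Section density.
Context {R : realType}.
Implicit Types (F G : R -> R) (x y : R).
Local Notation leb := (@lebesgue_measure R).

Lemma abs_cont_continuous F : abs_cont F -> continuous F.
Proof.
move=> acF x; apply/cvgrPdist_lt => e /acF[d d0 Fd].
exists d => //= y; rewrite /ball_ /= => xy.
have [yx|/ltW yx] := leP y x.
  have := Fd [:: (y, x)]; rewrite /interval_family /total_length !big_seq1 /= yx.
  by apply => //; rewrite ger0_norm ?subr_ge0// in xy.
have := Fd [:: (x, y)]; rewrite /interval_family /total_length !big_seq1 /= yx.
by rewrite distrC; apply => //; rewrite distrC ger0_norm ?subr_ge0// in xy.
Qed.

Lemma bounded_open_interval (I : set R) (a b : R) :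
  open I -> is_interval I -> I `<=` `]a, b[ -> I !=set0 ->
  inf I < sup I /\ I = `]inf I, sup I[.
Proof.
move=> oI iI Iab [z Iz].
have IE : I = `]inf I, sup I[.
  transitivity I°; first exact/esym/interior_id.
    rewrite interval_bounded_interior//.
  - by exists a => t /Iab /=; rewrite in_itv/= => /andP[/ltW].
  - by exists b => t /Iab /=; rewrite in_itv/= => /andP[_ /ltW].
split => //; move: Iz; rewrite {1}IE /= in_itv/= => /andP[]; exact: lt_trans.
Qed.

Lemma nonoverlap_disjoint (p q : R * R) : p.1 < p.2 -> q.1 < q.2 ->
  `]p.1, p.2[ `&` `]q.1, q.2[ = set0 -> nonoverlap p q.
Proof.
case: p q => [a b] [c d] /= ab cd H; apply/negPn/negP.
rewrite /nonoverlap /= negb_or -!ltNge => /andP[cb ad].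
have ltm : Num.max a c < Num.min b d.
  by rewrite lt_min !gt_max ab cb ad cd.
have [m1 m2] := midf_lt ltm.
move: m1 m2; set m := (_ / _); rewrite gt_max lt_min => /andP[? ?] /andP[? ?].
have : (`]a, b[ `&` `]c, d[) m by split; rewrite /= in_itv/=; apply/andP.
by rewrite H.
Qed.

Section monotone.
Variable G : R -> R.
Hypothesis ndG : {homo G : x y / x <= y}.
Hypothesis acG : abs_cont G.

Lemma G_right_continuous : right_continuous G.
Proof. by apply: right_continuousW; exact: abs_cont_continuous. Qed.

Definition cumG : cumulative R R :=
  HB.pack_for (cumulative R R) G (isCumulative.Build R _ R G ndG G_right_continuous).

Local Notation nu := (lebesgue_stieltjes_measure cumG).

Lemma nu_oc x y : x <= y -> nu `]x, y] = (G y - G x)%:E.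
Proof.
move=> xy.
rewrite /lebesgue_stieltjes_measure /measure_extension measurable_mu_extE/=.
  by rewrite wlength_itv_bnd.
exact: is_ocitv.
Qed.

Lemma nu01_lty : (nu `]0%R, 1%R] < +oo)%E.
Proof. by rewrite nu_oc ?ler01// ltry. Qed.

(** An open set is a disjoint union of open intervals. Absolute continuity bounds
    the increments of G over finitely many of them, uniformly in their number,
    and the measure of the union is the limit. *)
Lemma nu_small_open (e : R) : 0 < e -> exists2 d, 0 < d &
  forall U : set R, open U -> U `<=` `]-1, 2[ -> (leb U < d%:E)%E ->
  (nu U <= e%:E)%E.
Proof.
move=> /acG[d d0 Gd]; exists d => // U oU Ub Ud.
pose I := open_disjoint_itv oU.
have mI i : measurable (I i) by apply: open_measurable; exact: open_disjoint_itv_open.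
have tI : trivIset setT I := open_disjoint_itv_trivIset (oU:=oU).
have UE : U = \bigcup_i I i := open_disjoint_itv_bigcup oU.
have IU i : I i `<=` U.
  by rewrite UE; exact: bigcup_sup.
have IE i : I i !=set0 -> inf (I i) < sup (I i) /\ I i = `]inf (I i), sup (I i)[.
  apply: (@bounded_open_interval _ (-1) 2).
  - exact: open_disjoint_itv_open.
  - exact: open_disjoint_itv_is_interval.
  - by apply: subset_trans Ub; exact: IU.
rewrite UE measure_bigcup//; last by move=> i _; exact: mI.
apply: lime_le.
  by apply: is_cvg_nneseries_cond => n _ _; exact: measure_ge0.
apply: nearW => K.
(* Empty components have no end points and are left out. *)
pose l := [seq (inf (I i), sup (I i)) | i <- iota 0 K & I i != set0].
have sumE (J : nat -> \bar R) :
    (forall i, I i = set0 -> J i = 0%E) ->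
    (\sum_(0 <= i < K | i \in [set: nat]) J i =
     \sum_(i <- iota 0 K | I i != set0) J i)%E.
  move=> J0; rewrite (_ : index_iota 0 K = iota 0 K) ?/index_iota ?subn0//.
  rewrite big_mkcond [RHS]big_mkcond; apply: eq_bigr => i _.
  by rewrite in_setT; case: ifPn => // /negPn/eqP/J0.
have famI : interval_family l.
  apply/andP; split.
    apply/allP => p /mapP[i]; rewrite mem_filter => /andP[/set0P/IE[ab _] _] ->.
    exact: ltW.
  rewrite /l pairwise_map; apply/(pairwiseP 0%N) => i j.
  rewrite !inE => iK jK ij.
  have allI := filter_all (fun i => I i != set0) (iota 0 K).
  have /set0P/IE[ai Ii] : I (nth 0%N [seq i <- iota 0 K | I i != set0] i) != set0.
    exact: (all_nthP 0%N allI).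
  have /set0P/IE[aj Ij] : I (nth 0%N [seq i <- iota 0 K | I i != set0] j) != set0.
    exact: (all_nthP 0%N allI).
  apply: nonoverlap_disjoint => //=; rewrite -Ii -Ij.
  move/trivIsetP : tI; apply => //.
  by rewrite nth_uniq ?filter_uniq ?iota_uniq// ltn_eqF.
have lenI : total_length l < d.
  rewrite -lte_fin; apply: le_lt_trans Ud.
  rewrite UE measure_bigcup//; last by move=> i _; exact: mI.
  apply: le_trans; last first.
    by apply: (nneseries_lim_ge K) => n _ _; exact: measure_ge0.
  rewrite sumE/=; last by move=> i /= ->; rewrite measure0.
  rewrite /total_length /l big_map big_filter -sumEFin le_eqVlt; apply/orP; left.
  apply/eqP; apply: eq_bigr => i /set0P/IE[ab iE].
  by rewrite [in RHS]iE lebesgue_measure_itv/= lte_fin ab.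
rewrite sumE/=; last by move=> i /= ->; rewrite measure0.
apply: (@le_trans _ _ (\sum_(p <- l) `|G p.2 - G p.1|)%:E); last first.
  by rewrite lee_fin ltW// Gd.
rewrite /l big_map big_filter -sumEFin; apply: lee_sum => i /set0P/IE[ab iE].
rewrite ger0_norm ?subr_ge0 ?ndG ?(ltW ab)// -nu_oc ?(ltW ab)//.
apply: le_measure; rewrite ?inE; [exact: mI|exact: measurable_itv|].
by rewrite [X in X `<=` _]iE; apply: subset_itvl; rewrite bnd_simp.
Qed.

(** The restriction to ]0, 1] makes the measure finite, as the Radon-Nikodym
    theorem requires. *)
Definition nu01 : {finite_measure set (measurableTypeR R) -> \bar R} :=
  @mfrestr _ (measurableTypeR R) R `]0%R, 1%R] nu
    (measurable_itv (Interval (BRight 0) (BRight 1))) nu01_lty.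

(** A set of Lebesgue measure 0 is contained in open sets of arbitrarily small
    Lebesgue measure, hence of arbitrarily small Stieltjes measure. *)
Lemma nu01_dominated : nu01 `<< leb.
Proof.
apply/null_content_dominatesP => N mN N0.
pose N1 := N `&` `]0, 1]%classic.
have mN1 : measurable N1 by apply: measurableI => //; exact: measurable_itv.
have N10 : leb N1 = 0%E.
  by apply/eqP; rewrite eq_le measure_ge0 andbT -N0 le_measure ?inE//; exact: subIsetl.
change (nu N1 = 0%E).
apply/eqP; rewrite eq_le measure_ge0 andbT.
apply/lee_addgt0Pr => e e0; rewrite add0e.
have [d d0 Hd] := nu_small_open e e0.
have N1lty : (leb N1 < +oo)%E by rewrite N10.
have [U [oU NU Ud]] := lebesgue_regularity_outer mN1 N1lty d0.
(* U is cut down to a bounded set, whose components are bounded. *)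
have oV : open (U `&` `]-1, 2[) by apply: openI => //; exact: interval_open.
apply: (le_trans _ (Hd _ oV _ _)).
- apply: le_measure; rewrite ?inE//; first exact: open_measurable.
  move=> t Nt; split; first exact: NU.
  by case: Nt => _ /=; rewrite !in_itv/= => /andP[? ?]; lra.
- exact: subIsetr.
- apply: le_lt_trans Ud.
  have mU : measurable U by exact: open_measurable.
  rewrite -[leRHS]adde0 -N10 -measureU//; last 2 first.
  + exact: measurableD.
  + by rewrite setDE -setIA setICl setI0.
  apply: le_measure; rewrite ?inE//.
  + exact: open_measurable.
  + by apply: measurableU => //; exact: measurableD.
  + move=> t [Ut _]; have [|] := pselect (N1 t); by [right|left].
Qed.

(** h is the Radon-Nikodym derivative of the Stieltjes measure of G. *)
Lemma monotone_density : exists h : R -> R,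
  leb.-integrable setT (EFin \o h) /\
  forall x y, 0 <= x -> x <= y -> y <= 1 ->
    ((G y - G x)%:E = \int[leb]_(t in `]x, y]) (h t)%:E)%E.
Proof.
have [f [f0 ffin fint fE]] := @radon_nikodym_sigma_finite _ _ _ leb nu01 nu01_dominated.
have fK : EFin \o (fine \o f) = f by apply/funext => t /=; rewrite fineK.
exists (fine \o f); rewrite fK; split => // x y x0 xy y1.
under eq_integral do rewrite /= fineK//.
rewrite -fE; last exact: measurable_itv.
rewrite -nu_oc//; change (nu `]x, y] = nu (`]x, y] `&` `]0, 1]))%classic.
congr (nu _); apply/seteqP; split => [t /=|t []//].
by rewrite !in_itv/= => /andP[? ?]; split; lra.
Qed.

End monotone.
End density.

(** * The fundamental theorem of calculus *)

Section completed.
Context {R : realType}.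
Local Notation leb := (@lebesgue_measure R).
Local Notation mu := (@completed_lebesgue_measure R).

Lemma borel_lebesgue (A : set R) : measurable A -> measurable (A : set (lebesgueType R)).
Proof. by move=> mA; exact: sub_caratheodory. Qed.

Lemma measurable_idR : measurable_fun setT (idfun : lebesgueType R -> measurableTypeR R).
Proof. by move=> _ B mB; rewrite setTI; exact: borel_lebesgue. Qed.

(** The completed measure restricts to the Lebesgue measure along the identity
    map, which is measurable from the Lebesgue sets to the Borel sets. *)
Lemma ge0_integral_completed (D : set R) (f : R -> \bar R) :
  measurable D -> measurable_fun D f -> (forall x, D x -> (0 <= f x)%E) ->
  (\int[mu]_(x in D) f x = \int[leb]_(x in D) f x)%E.
Proof.
move=> mD mf f0.
rewrite -(@ge0_integral_pushforward _ _ _ _ R _ measurable_idR mu D f)//; last first.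
  by move=> x; rewrite inE; exact: f0.
Qed.

Lemma ae_completed (P : R -> Prop) : {ae leb, forall x, P x} -> {ae mu, forall x, P x}.
Proof.
by move=> [N [mN N0 NP]]; exists N; split => //; exact: borel_lebesgue.
Qed.

Lemma integrable_itv (h : R -> \bar R) (i : interval R) :
  leb.-integrable setT h -> leb.-integrable [set` i] h.
Proof. by apply: integrableS => //; exact: measurable_itv. Qed.

(** With V the total variation of F, both V and V - F are monotone and
    absolutely continuous; v is the difference of their densities, and the
    Lebesgue differentiation theorem identifies it with the derivative. *)
Lemma abs_cont_ftc (F : R -> R) : absolutely_continuous 0 1 F ->
  exists v : R -> R, [/\ leb.-integrable setT (EFin \o v),
    (forall x y, 0 <= x -> x <= y -> y <= 1 ->
      ((F y - F x)%:E = \int[leb]_(t in `]x, y]) (v t)%:E)%E) &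
    {ae leb, forall x, 0 < x < 1 -> derivable F x 1 /\ F^`() x = v x}].
Proof.
move=> /abs_cont_clamp; set Fc := F \o clamp01 => acF.
pose V := tv01 Fc; pose W := V \- Fc.
have Fcc x : Fc (clamp01 x) = Fc x.
  by rewrite /Fc /= (clamp01_id (clamp01 x)) ?clamp01_bounds.
have dV x y : x <= y -> `|Fc y - Fc x| <= V y - V x.
  by move=> xy; have := tv01_ge Fc x y acF xy; rewrite !Fcc.
have ndV : {homo V : x y / x <= y} by move=> x y; exact: tv01_homo.
have ndW : {homo W : x y / x <= y}.
  move=> x y /dV h; rewrite /W /=; have := ler_norm (Fc y - Fc x).
  by move: h; rewrite -/V; lra.
have acV : abs_cont V by exact: abs_cont_tv01.
have acW : abs_cont W.
  move=> e e0; have [|d d0 Vd] := acV (e / 2); first lra.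
  exists d => // l lf ld; have := Vd l lf ld.
  suff : \sum_(p <- l) `|W p.2 - W p.1| <= \sum_(p <- l) `|V p.2 - V p.1| *+ 2.
    by rewrite sumrMnl mulr2n => h1 h2; apply: le_lt_trans h1 _; lra.
  rewrite big_seq [leRHS]big_seq; apply: ler_sum => p pl.
  have p12 : p.1 <= p.2 by case/andP : lf => /allP /(_ p pl).
  rewrite !ger0_norm ?subr_ge0 ?ndV ?ndW// /W /=.
  have := dV _ _ p12; have := ler_norm (- (Fc p.2 - Fc p.1)); rewrite normrN.
  by rewrite mulr2n; lra.
have [h1 [ih1 h1E]] := monotone_density _ ndV acV.
have [h2 [ih2 h2E]] := monotone_density _ ndW acW.
have iv : leb.-integrable setT (EFin \o (h1 \- h2)).
  by have := integrableB measurableT ih1 ih2; apply: eq_integrable.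
have vE x y : 0 <= x -> x <= y -> y <= 1 ->
  ((F y - F x)%:E = \int[leb]_(t in `]x, y]) ((h1 \- h2) t)%:E)%E.
  move=> x0 xy y1.
  have -> : F y - F x = (V y - V x) - (W y - W x).
    rewrite /W /Fc /= !clamp01_id; last 2 first.
      by rewrite x0 (le_trans xy).
      by rewrite (le_trans x0 xy).
    ring.
  rewrite EFinB h1E// h2E// -integralB//.
    exact: integrable_itv ih1.
  exact: integrable_itv ih2.
exists (h1 \- h2); split => //.
have := @FTC1 R (h1 \- h2) (BRight 0).
set H := fun x => _ => FTC.
have {FTC} := FTC (fun y => integrable_itv _ _ iv)
  (open_integrable_locally openT iv).
apply: filterS; first exact: (ae_filter_ringOfSetsType leb). move=> x Hx /andP[x0 x1].
have {Hx} [dH HE] := Hx x0.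
have isH : is_derive x 1 H ((h1 \- h2) x).
  by rewrite -HE derive1E; exact: derivableP.
have isF : is_derive x 1 F ((h1 \- h2) x).
  apply: (@near_eq_is_derive _ _ _ (cst (F 0) \+ H)).
    near=> t.
    have t0 : 0 < t by near: t; exact: lt_nbhsr.
    have t1 : t < 1 by near: t; exact: lt_nbhsl.
    suff Ht : H t = F t - F 0 by rewrite /= Ht; ring.
    apply: EFin_inj; rewrite (vE 0 t) ?lexx ?ltW//.
    by rewrite /H /Rintegral fineK//; apply: integrable_fin_num => //; exact: integrable_itv iv.
  rewrite -[X in is_derive _ _ _ X]add0r.
  exact: is_deriveD.
have [dF DF] := isF; split; first exact: dF.
by rewrite derive1E DF.
Unshelve. all: by end_near.
Qed.

(** Half-open, so that adjacent windows add up exactly. *)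
Definition wint (g : R -> R) (a b : R) : \bar R := (\int[mu]_(t in `[a, b[) `|g t|%:E)%E.

(** This is the only consequence of absolute continuity used below. *)
Lemma abs_cont_increment (F : R -> R) x y : absolutely_continuous 0 1 F ->
  measurable_fun setT (F^`() : lebesgueType R -> R) ->
  0 <= x -> x <= y -> y <= 1 ->
  (`|F y - F x|%:E <= wint F^`() x y)%E.
Proof.
move=> /abs_cont_ftc[v [iv vE]].
move: (F^`()) => F1 vF mF x0 xy y1.
have mv : measurable_fun setT v by apply/measurable_EFinP; exact: (measurable_int _ iv).
have mv' : measurable_fun setT (fun t => `|v t|%:E).
  by apply/measurable_EFinP; exact: measurableT_comp.
rewrite -abse_EFin vE//.
apply: (le_trans (le_abse_integral _ _ _)) => //.
  by apply: (@measurable_funS _ _ _ _ setT) => //; exact/measurable_EFinP.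
under eq_integral do rewrite abse_EFin.
rewrite -integral_itv_bndo_bndc; last exact: measurable_funS mv'.
rewrite -ge0_integral_completed//; last exact: measurable_funS mv'.
have mv'' : measurable_fun setT ((fun t => `|v t|%:E) : lebesgueType R -> \bar R).
  exact: (measurable_comp measurableT _ mv' measurable_idR).
have mF' : measurable_fun setT ((fun t => `|F1 t|%:E) : lebesgueType R -> \bar R).
  by apply/measurable_EFinP; exact: measurableT_comp.
have mI (i : interval R) : measurable ([set` i] : set (lebesgueType R)).
  by apply: borel_lebesgue; exact: measurable_itv.
rewrite /wint (@ae_eq_integral _ (lebesgueType R) R mu _ (fun t : lebesgueType R => `|F1 t|%:E)).
- apply: (ge0_subset_integral _ (mI _) (mI _)).
  + exact: measurable_funS mF'.
  + by move=> t _; rewrite lee_fin.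
  + by apply: subset_itvr; rewrite bnd_simp.
- exact: mI.
- exact: measurable_funS mv''.
- exact: measurable_funS mF'.
- have := ae_completed _ vF; apply: filterS; first exact: (ae_filter_ringOfSetsType mu).
  move=> t Ht /=; rewrite in_itv/= => /andP[xt ty].
  by have [|_ ->//] := Ht; lra.
Qed.

End completed.

(** * Affine changes of variable *)

Section affine.
Context {R : realType}.
Local Notation leb := (@lebesgue_measure R).
Local Notation mu := (@completed_lebesgue_measure R).
Variables a c : R.
Hypothesis c0 : c != 0.

Definition affine (t : R) := a + c * t.

Lemma measurable_affine : measurable_fun setT affine.
Proof.
by apply: measurable_funD => //; exact: measurable_funM.
Qed.

Let absc0 : 0 <= `|c|. Proof. by []. Qed.

Let scaled : {measure set (measurableTypeR R) -> \bar R}.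
Proof.
refine (mscale (NngNum absc0)
  (pushforward (leb : {measure set (measurableTypeR R) -> \bar R})
     (affine : measurableTypeR R -> measurableTypeR R))).
exact: measurable_affine.
Defined.

Lemma scaled_oc x y : x < y -> scaled `]x, y] = leb `]x, y].
Proof.
move=> xy; change (`|c|%:E * leb (affine @^-1` `]x, y]) = leb `]x, y])%E.
have [cp|cn|cE] := ltgtP c 0; last by case/eqP : c0.
  have -> : affine @^-1` `]x, y] = `[(y - a) / c, (x - a) / c[.
    apply/seteqP; split => t; rewrite /= !in_itv /affine /=.
      by rewrite ler_ndivrMr// ltr_ndivlMr// => /andP[? ?]; apply/andP; split; lra.
    by rewrite ler_ndivrMr// ltr_ndivlMr// => /andP[? ?]; apply/andP; split; lra.
  rewrite !lebesgue_measure_itv/= !lte_fin xy.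
  rewrite ltr_ndivrMr// divfK// ltrD2r xy -!EFinB -EFinM.
  by congr EFin; rewrite ltr0_norm//; field.
have -> : affine @^-1` `]x, y] = `](x - a) / c, (y - a) / c].
  apply/seteqP; split => t; rewrite /= !in_itv /affine /=.
    by rewrite ler_pdivlMr// ltr_pdivrMr// => /andP[? ?]; apply/andP; split; lra.
  by rewrite ler_pdivlMr// ltr_pdivrMr// => /andP[? ?]; apply/andP; split; lra.
rewrite !lebesgue_measure_itv/= !lte_fin xy.
rewrite ltr_pdivrMr// divfK// ltrD2r xy -!EFinB -EFinM.
by congr EFin; rewrite gtr0_norm//; field.
Qed.

(** The scaled image measure agrees with the Lebesgue measure on half-open
    intervals, hence everywhere. *)
Lemma lebesgue_affine (A : set R) : measurable A ->
  (leb A = `|c|%:E * leb (affine @^-1` A))%E.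
Proof.
move=> mA; rewrite (@lebesgue_measure_unique _ scaled)//.
move=> X /ocitvP[->|[[x y] /= xy ->]]; first by rewrite !measure0.
by rewrite scaled_oc.
Qed.

Lemma negligible_affine (N : set R) : measurable N -> leb N = 0%E ->
  leb (affine @^-1` N) = 0%E.
Proof.
move=> mN N0; have := lebesgue_affine _ mN; rewrite N0 => /esym/eqP.
rewrite mule_eq0 eqe normr_eq0 (negbTE c0)/= => /eqP; exact.
Qed.

(** A Lebesgue set is a Borel set up to a subset of a Borel null set; both kinds
    of sets behave well under affine maps. *)
Lemma lebesgue_measurableE (A : set R) : measurable (A : set (lebesgueType R)) ->
  exists B N F : set R, [/\ measurable B, measurable F, leb F = 0%E, N `<=` F & A = B `|` N].
Proof.
move=> mA.
have : (completed_algebra_gen leb) A.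
  by rewrite -g_sigma_completed_algebra_genE completed_caratheodory_measurable.
move=> [B mB [N [F [mF F0 NF]] <-]].
by exists B, N, F.
Qed.

Lemma measurable_lebesgue_affine :
  measurable_fun setT (affine : lebesgueType R -> lebesgueType R).
Proof.
move=> _ A /lebesgue_measurableE[B [N [F [mB mF F0 NF ->]]]].
rewrite setTI preimage_setU.
apply: measurableU.
  apply: borel_lebesgue; rewrite -[X in measurable X]setTI.
  exact: measurable_affine.
apply: negligible_sub_caratheodory; exists (affine @^-1` F); split.
- apply: borel_lebesgue; rewrite -[X in measurable X]setTI.
  exact: measurable_affine.
- exact: negligible_affine.
- exact: preimage_subset.
Qed.

Lemma completed_affine (A : set (lebesgueType R)) : measurable A ->
  (mu A = `|c|%:E * mu (affine @^-1` A))%E.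
Proof.
move=> /lebesgue_measurableE[B [N [F [mB mF F0 NF ->]]]].
have maff (E : set R) : measurable E -> measurable (affine @^-1` E).
  by move=> mE; rewrite -[X in measurable X]setTI; exact: measurable_affine.
have key (B' N' F' : set R) : measurable B' -> measurable F' -> leb F' = 0%E ->
    N' `<=` F' -> mu (B' `|` N') = leb B'.
  move=> mB' mF' F'0 NF'.
  have mN' : measurable (N' : set (lebesgueType R)).
    by apply: negligible_sub_caratheodory; exists F'; split => //; exact: borel_lebesgue.
  rewrite measureU0//; first exact: borel_lebesgue.
  apply: (@subset_measure0 _ _ _ mu N' F') => //; exact: borel_lebesgue.
rewrite preimage_setU (key _ _ F)// (key _ _ (affine @^-1` F))//.
- exact: lebesgue_affine.
- exact: maff.
- exact: maff.
- exact: negligible_affine.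
- exact: preimage_subset.
Qed.

Let cscaled : {measure set (lebesgueType R) -> \bar R}.
Proof.
refine (mscale (NngNum absc0)
  (pushforward (mu : {measure set (lebesgueType R) -> \bar R})
     (affine : lebesgueType R -> lebesgueType R))).
exact: measurable_lebesgue_affine.
Defined.

Lemma ge0_integral_affine (D : set (lebesgueType R)) (f : lebesgueType R -> \bar R) :
  measurable D -> measurable_fun D f -> (forall x, D x -> (0 <= f x)%E) ->
  (\int[mu]_(x in D) f x = `|c|%:E * \int[mu]_(x in affine @^-1` D) f (affine x))%E.
Proof.
move=> mD mf f0.
rewrite (_ : (\int[mu]_(x in D) f x = \int[cscaled]_(x in D) f x)%E); last first.
  by apply: eq_measure_integral => A mA AD; exact: completed_affine.
have fD : {in D, forall x, (0 <= f x)%E} by move=> x; rewrite inE; exact: f0.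
rewrite (ge0_integral_mscale _ mD _ mf f0) /=.
by rewrite (ge0_integral_pushforward measurable_lebesgue_affine mu mD mf fD).
Qed.

End affine.

(** * Integrals over windows *)

Section wint.
Context {R : realType}.
Implicit Types (g : R -> R) (a b c x : R).

Definition lebfun g := measurable_fun setT (g : lebesgueType R -> R).

Lemma lebesgue_itv_measurable (i : interval R) : measurable ([set` i] : set (lebesgueType R)).
Proof. by apply: borel_lebesgue; exact: measurable_itv. Qed.

Lemma lebfun_norm g (D : set (lebesgueType R)) : lebfun g ->
  measurable_fun D ((fun t => `|g t|%:E) : lebesgueType R -> \bar R).
Proof.
move=> mg; apply: (measurable_funS measurableT (@subsetT _ _)).
by apply/measurable_EFinP; exact: measurableT_comp.
Qed.

Lemma lebfun_affine g x c : c != 0 -> lebfun g -> lebfun (g \o affine x c).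
Proof.
move=> c0 mg.
exact: (measurable_comp measurableT (@subsetT _ _) mg (measurable_lebesgue_affine x c c0)).
Qed.

Lemma lebfun_powR g (p : R) : lebfun g -> lebfun (fun t => `|g t| `^ p).
Proof.
move=> mg; apply: (measurableT_comp (measurable_powR p)).
exact: measurableT_comp.
Qed.

Lemma wint_ge0 g a b : (0 <= wint g a b)%E.
Proof. by apply: integral_ge0. Qed.

Lemma wint_norm g a b : wint (fun t => `|g t|) a b = wint g a b.
Proof. by apply: eq_integral => t _; rewrite normr_id. Qed.

Lemma wint_cat g a b c : lebfun g -> a <= b -> b <= c ->
  wint g a c = (wint g a b + wint g b c)%E.
Proof.
move=> mg ab bc; rewrite /wint (@itv_bndbnd_setU _ _ _ (BLeft b)) ?bnd_simp//.
rewrite (ge0_integral_setU _ (lebesgue_itv_measurable _) (lebesgue_itv_measurable _)).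
- by [].
- exact: lebfun_norm.
- by move=> t _; rewrite lee_fin.
apply/disj_setPLR => t /=; rewrite !in_itv/= => /andP[_ tb].
by apply/negP; rewrite negb_and -ltNge tb.
Qed.

Lemma wint_le g a b a' b' : lebfun g -> a' <= a -> b <= b' ->
  (wint g a b <= wint g a' b')%E.
Proof.
move=> mg aa bb.
apply: (ge0_subset_integral _ (lebesgue_itv_measurable _) (lebesgue_itv_measurable _)).
- exact: lebfun_norm.
- by move=> t _; rewrite lee_fin.
move=> t /=; rewrite !in_itv/= => /andP[at_ tb].
by rewrite (le_trans aa) //= (lt_le_trans tb).
Qed.

Lemma wint_affine g a b x c : lebfun g -> 0 < c ->
  wint g (x + c * a) (x + c * b) = (c%:E * wint (g \o affine x c) a b)%E.
Proof.
move=> mg c0; have cN0 : c != 0 by rewrite gt_eqF.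
rewrite /wint (ge0_integral_affine x c cN0 _ _ (lebesgue_itv_measurable _) (lebfun_norm _ _ mg));
  last by move=> t _; rewrite lee_fin.
rewrite gtr0_norm//; congr (_ * integral _ _ _)%E.
apply/seteqP; split => t /=; rewrite !in_itv/= /affine;
  by rewrite lerD2l ltrD2l ler_pM2l// ltr_pM2l.
Qed.

Lemma wint_shift g a b x : lebfun g ->
  wint (fun t => g (t + x)) a b = wint g (a + x) (b + x).
Proof.
move=> mg; have := wint_affine g a b x 1 mg ltr01.
rewrite !mul1r mul1e => /esym; rewrite ![x + _]addrC => <-.
by apply: eq_integral => t _; rewrite /= /affine mul1r addrC.
Qed.

Lemma lebfun_shift g x : lebfun g -> lebfun (fun t => g (t + x)).
Proof.
move=> /(lebfun_affine g x 1 (oner_neq0 _)); congr lebfun.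
by apply/funext => t; rewrite /= /affine mul1r addrC.
Qed.

Lemma periodicz g (k : int) : periodic g 1 -> forall t, g (t + k%:~R) = g t.
Proof.
move=> pg t; case: (intP k) => [|n|n]; first by rewrite addr0.
  by rewrite -pmulrn; exact: periodicn.
rewrite -{2}(subrK (n.+1%:R : R) t) (periodicn pg n.+1) mulrNz.
by rewrite -pmulrn.
Qed.

Lemma wint_shiftz g a b (k : int) : lebfun g -> periodic g 1 ->
  wint g (a + k%:~R) (b + k%:~R) = wint g a b.
Proof.
move=> mg pg; rewrite -wint_shift//.
by congr wint; apply/funext => t; exact: periodicz.
Qed.

(** Cut the period [a, a + 1[ at the next integer and move the right part back
    by 1. *)
Lemma wint_period g a : lebfun g -> periodic g 1 ->
  wint g a (a + 1) = wint g 0 1.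
Proof.
move=> mg pg; set k := Num.floor a; pose t := a - k%:~R.
have /andP[ka ak] := Num.Theory.floor_itv a; rewrite intrD -/k in ka ak.
have t0 : 0 <= t by rewrite /t; lra.
have t1 : t < 1 by rewrite /t; lra.
have -> : wint g a (a + 1) = wint g (t + k%:~R) (t + 1 + k%:~R).
  by rewrite /t subrK [a - _ + 1 + _]addrAC subrK.
rewrite wint_shiftz//.
rewrite (wint_cat _ _ 1)//; [|lra|lra].
have /= := wint_shiftz g 0 t 1 mg pg; rewrite add0r => ->.
by rewrite addeC -wint_cat//; lra.
Qed.

End wint.

(** * The p-norm and sums over windows *)

Section holder.
Context {R : realType}.
Local Notation mu := (@completed_lebesgue_measure R).
Implicit Types (g : R -> R) (a b c x p : R).

Definition normpow p g : R -> R := fun t => `|g t| `^ p.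

Lemma Lnorm_restrict p g a b : p != 0 ->
  Lnorm mu p%:E (EFin \o (g \_ `[a, b[)) =
  poweR (wint (normpow p g) a b) p^-1.
Proof.
move=> p0; rewrite unlock; congr poweR.
rewrite /wint [RHS]integral_mkcond; apply: eq_integral => t _.
rewrite /= /patch; case: ifPn => _.
  by rewrite (ger0_norm (powR_ge0 _ _)).
by rewrite normr0 powR0.
Qed.

Lemma lebfun_restrict g a b : lebfun g -> lebfun (g \_ `[a, b[).
Proof.
move=> mg; apply/(measurable_restrictT _ _).1; first exact: lebesgue_itv_measurable.
exact: measurable_funS mg.
Qed.

Lemma lebesgue_itv_co a b : a <= b -> mu `[a, b[ = (b - a)%:E.
Proof.
move=> ab; rewrite -[LHS]/(lebesgue_measure `[a, b[) lebesgue_measure_itv/= lte_fin.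
move: ab; rewrite le_eqVlt => /predU1P[->|->//].
by rewrite ltxx subrr.
Qed.

(** The Hoelder inequality against the indicator function of the window. *)
Lemma wint_holder p g a b : 1 <= p -> lebfun g -> a <= b ->
  (wint g a b <= (powR (b - a) (1 - p^-1))%:E *
     poweR (wint (normpow p g) a b) p^-1)%E.
Proof.
rewrite le_eqVlt => /predU1P[<-|p1] mg ab.
  rewrite invr1 subrr powRr0 mul1e poweRe1 ?wint_ge0//.
  by rewrite (_ : normpow 1 g = fun t => `|g t|) ?wint_norm//;
    apply/funext => t; rewrite /normpow powRr1.
have p0 : 0 < p by lra.
pose q := (1 - p^-1)^-1.
have p1' : p^-1 < 1 by rewrite invf_lt1.
have q0 : 0 < q by rewrite invr_gt0; lra.
have pq : p^-1 + q^-1 = 1 by rewrite invrK; ring.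
have m1 : lebfun (cst 1 : R -> R) by exact: measurable_cst.
have := hoelder mu (lebfun_restrict g a b mg) (lebfun_restrict (cst 1) a b m1) p0 q0 pq.
rewrite !Lnorm_restrict ?gt_eqF// invrK.
rewrite [X in (_ <= _ * poweR X _)%E](_ : _ = (b - a)%:E); last first.
  rewrite /wint -lebesgue_itv_co// -[RHS]mul1e -integral_cst; last exact: lebesgue_itv_measurable.
  by apply: eq_integral => t _; rewrite /normpow /= normr1 powR1 normr1.
rewrite poweR_EFin muleC; apply: le_trans.
rewrite Lnorm1 /wint [X in (X <= _)%E]integral_mkcond le_eqVlt; apply/orP; left; apply/eqP.
apply: eq_integral => t _; rewrite /= /patch; case: ifPn => _ /=.
  by rewrite mulr1.
by rewrite mul0r normr0.
Qed.

Lemma pnorm_ge0 p g : (0 <= pnorm p g)%E.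
Proof. exact: Lnorm_ge0. Qed.

Lemma pnormE p g : p != 0 -> pnorm p g = poweR (wint (normpow p g) 0 1) p^-1.
Proof. exact: Lnorm_restrict. Qed.

Lemma wint_pnorm p g : p != 0 -> wint (normpow p g) 0 1 = poweR (pnorm p g) p.
Proof.
by move=> p0; rewrite pnormE// -poweRrM mulVf// poweRe1// wint_ge0.
Qed.

Definition rnorm p g := fine (pnorm p g).

Lemma rnormE p g : Lp p g -> pnorm p g = (rnorm p g)%:E.
Proof. by move=> [_ _ gfin]; rewrite fineK// ge0_fin_numE// pnorm_ge0. Qed.

Lemma rnorm_ge0 p g : 0 <= rnorm p g.
Proof. by rewrite fine_ge0// pnorm_ge0. Qed.

(** By the Hoelder inequality, |H_j|^p is at most B^p l^(p-1) times the integral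
    of |g|^p over the j-th window; M bounds the overlap of the windows, so the
    sum of these integrals is at most M times the integral over a period. *)
Lemma window_sum p (n : nat) (y H : 'I_n -> R) g (l M B : R) :
  1 <= p -> 0 < l -> 0 <= B -> Lp p g ->
  (forall G : R -> R, lebfun G -> periodic G 1 ->
     (\sum_(j < n) wint G (y j) (y j + l)%R <= M%:E * wint G 0%R 1%R)%E) ->
  (forall j, (`|H j|%:E <= B%:E * wint g (y j) (y j + l)%R)%E) ->
  \sum_(j < n) `|H j| `^ p <= (B * l) `^ p * l^-1 * (M * rnorm p g `^ p).
Proof.
move=> p1 l0 B0 gLp yM HB; have [pg mg _] := gLp.
have p0 : 0 < p by lra.
have pN0 : p != 0 by rewrite gt_eqF.
set G := normpow p g.
have mG : lebfun G by exact: lebfun_powR.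
have pG : periodic G 1 by move=> t; rewrite /G /normpow pg.
have := yM G mG pG; rewrite wint_pnorm// rnormE// poweR_EFin -EFinM => sumG.
have Gfin j : wint G (y j) (y j + l) \is a fin_num.
  rewrite ge0_fin_numE ?wint_ge0//; apply: le_lt_trans (ltry (M * rnorm p g `^ p)).
  apply: le_trans sumG; rewrite (bigD1 j)//= leeDl// sume_ge0// => i _.
  exact: wint_ge0.
pose W j := fine (wint G (y j) (y j + l)).
have WE j : wint G (y j) (y j + l) = (W j)%:E by rewrite fineK.
have W0 j : 0 <= W j by rewrite fine_ge0// wint_ge0.
have HW j : `|H j| `^ p <= (B * l) `^ p * l^-1 * W j.
  have : `|H j| <= B * (l `^ (1 - p^-1) * W j `^ p^-1).
    rewrite -lee_fin; apply: le_trans (HB j) _.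
    rewrite EFinM; apply: lee_wpmul2l; first by rewrite lee_fin.
    have := @wint_holder p g (y j) (y j + l) p1 mg.
    rewrite (_ : y j + l - y j = l); last ring.
    rewrite lerDl (ltW l0) WE poweR_EFin -EFinM; exact.
  move/(ge0_ler_powR (ltW p0)); rewrite !nnegrE normr_ge0.
  rewrite !mulr_ge0 ?powR_ge0// => /(_ isT isT)/le_trans; apply.
  rewrite powRM ?mulr_ge0 ?powR_ge0// powRM ?powR_ge0// -!powRrM.
  rewrite mulVf// powRr1// mulrBl mul1r mulVf// mulrA.
  rewrite powRM ?(ltW l0)//.
  rewrite powRB ?(gt_eqF l0) ?implybT// powRr1 ?(ltW l0)//.
  by rewrite mulrA.
apply: le_trans (ler_sum _ (fun j _ => HW j)) _.
rewrite -mulr_sumr ler_wpM2l ?mulr_ge0 ?powR_ge0 ?invr_ge0 ?(ltW l0)//.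
rewrite -lee_fin -sumEFin; apply: le_trans sumG.
by under eq_bigr do rewrite -WE.
Qed.

End holder.

(** * Linear functionals annihilating polynomials *)

Section moments.
Context {R : realType}.
Implicit Types (a b : R).

(** The m-th difference annihilates the polynomials of degree < m. Multiplying
    the j-th power by one more linear factor either repeats the previous case or
    lowers m by one, because nu * 'C(m, nu) = m * 'C(m.-1, nu.-1). *)
Lemma binomial_moment m j a b : (j < m)%N ->
  \sum_(nu < m.+1) 'C(m, nu)%:R * (-1) ^+ nu * (a + b * nu%:R) ^+ j = 0 :> R.
Proof.
elim: j m a => [|j ih] m a jm.
  have := exprBn (1 : R) 1 m; rewrite subrr expr0n gtn_eqF//= => /esym S0.
  rewrite -[RHS]S0; apply: eq_bigr => nu _.
  by rewrite expr0 !expr1n !mulr1 mulr_natl.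
case: m jm => // m jm.
under eq_bigr do rewrite exprS mulrDl mulrDr !mulrA.
rewrite big_split /=.
(* the constant part a of the extra factor a + b nu *)
rewrite [X in X + _](_ : _ = a * \sum_(nu < m.+2)
    'C(m.+1, nu)%:R * (-1) ^+ nu * (a + b * nu%:R) ^+ j); last first.
  by rewrite mulr_sumr; apply: eq_bigr => nu _; ring.
rewrite ih ?mulr0 ?add0r; last exact: ltnW.
rewrite big_ord_recl /= mulr0 mul0r add0r.
(* the part b nu, which shifts the summation index by one *)
transitivity (- b * m.+1%:R * \sum_(nu < m.+1)
    'C(m, nu)%:R * (-1) ^+ nu * (a + b + b * nu%:R) ^+ j); last by rewrite ih// mulr0.
rewrite mulr_sumr; apply: eq_bigr => nu _.
have := mul_bin_diag m.+1 nu; rewrite /= => E.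
have {}E : m.+1%:R * 'C(m, nu)%:R = nu.+1%:R * 'C(m.+1, nu.+1)%:R :> R.
  by rewrite -!natrM E.
have n1 : nu.+1%:R = nu%:R + 1 :> R by rewrite natr1.
rewrite /bump /= add1n exprS n1 in E *.
rewrite (_ : a + b * (nu%:R + 1) = a + b + b * nu%:R); last ring.
set X := _ ^+ j.
transitivity (- b * ((nu%:R + 1) * 'C(m.+1, nu.+1)%:R) * (-1) ^+ nu * X); first ring.
by rewrite -E; ring.
Qed.

(** Set psi(t) = \sum_i c_i Q(x + t a_i). Each derivative of psi up to order k
    vanishes at 0 by the moment conditions and has the same form as psi, with Q
    replaced by its derivative and c_i by c_i a_i; so the mean value theorem
    reduces the claim to the k-th derivative, where it is an oscillation bound. *)
Lemma moment_bound (k m : nat) (c a : 'I_m -> R) (Q : R -> R) (x A : R) :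
  (forall (i : nat) y, (i < k)%N -> derivable Q^`(i) y 1) ->
  (forall i t, 0 <= t <= 1 -> `|Q^`(k)%classic (x + t * a i) - Q^`(k)%classic x| <= A) ->
  (forall j, (j <= k)%N -> \sum_(i < m) c i * a i ^+ j = 0) ->
  forall t, 0 <= t <= 1 ->
  `|\sum_(i < m) c i * Q (x + t * a i)| <= A * \sum_(i < m) `|c i| * `|a i| ^+ k.
Proof.
elim: k c Q => [|k ih] c Q dQ QA cm t t01.
  have c0 : \sum_(i < m) c i = 0.
    by rewrite -[RHS](cm 0%N)//; apply: eq_bigr => i _; rewrite mulr1.
  rewrite (_ : \sum_(i < m) _ = \sum_(i < m) c i * (Q (x + t * a i) - Q x)); last first.
    under [RHS]eq_bigr do rewrite mulrBr.
    by rewrite sumrB -mulr_suml c0 mul0r subr0.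
  apply: le_trans (ler_norm_sum _ _ _) _; rewrite mulr_sumr.
  apply: ler_sum => i _; rewrite normrM expr0 mulr1 mulrC ler_wpM2r//.
  exact: QA.
pose psi t := \sum_(i < m) c i * Q (x + t * a i).
pose Q' : R -> R := Q^`().
pose dpsi t := \sum_(i < m) (c i * a i) * Q' (x + t * a i).
have dpsiE (u : R) : is_derive u 1 psi (dpsi u).
  have H (i : 'I_m) : is_derive u (1 : R) (fun t : R => c i * Q (x + t * a i))
      (c i * a i * Q' (x + u * a i)).
    have dq : is_derive (x + u * a i) 1 Q (Q' (x + u * a i)).
      by rewrite /Q' derive1E; apply/derivableP; exact: (dQ 0%N).
    have da : is_derive u (1 : R) (cst x + (a i \*: id) : R -> R) (0 + a i *: 1).
      exact: is_deriveD.
    have dqa : is_derive u (1 : R) (c i \*: (Q \o (cst x + (a i \*: id))))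
        (c i *: (Q' (x + u * a i) * (0 + a i *: 1))).
      apply: is_deriveZ; apply: is_derive1_comp.
      rewrite (_ : _ u = x + u * a i)//.
      by rewrite /= mulrC.
    rewrite (_ : c i * a i * Q' (x + u * a i) = c i *: (Q' (x + u * a i) * (0 + a i *: 1))).
      rewrite (_ : (fun t : R => _) = c i \*: (Q \o (cst x + (a i \*: id))))//.
      by apply/funext => v /=; congr (_ * Q (_ + _)); rewrite mulrC.
    by rewrite add0r /GRing.scale/=; ring.
  have := is_derive_sum H.
  congr is_derive; apply/funext => v; by rewrite fct_sumE.
have psi0 : psi 0 = 0.
  rewrite /psi; under eq_bigr do rewrite mul0r addr0.
  rewrite -mulr_suml; have := cm 0%N isT.
  by under eq_bigr do rewrite mulr1; move=> ->; rewrite mul0r.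
have dpsiA u : 0 <= u <= 1 -> `|dpsi u| <= A * \sum_(i < m) `|c i| * `|a i| ^+ k.+1.
  move=> u01; have := ih (fun i => c i * a i) Q' _ _ _ u u01.
  under [X in _ -> _ -> _ -> _ <= _ * X]eq_bigr do rewrite normrM -mulrA -exprS.
  have dQE i : Q'^`(i) = Q^`(i.+1) by rewrite derive1Sn.
  apply.
  - by move=> i y ik; rewrite dQE; exact: dQ.
  - by move=> i v v01; rewrite dQE; exact: QA.
  - by move=> j jk; under eq_bigr do rewrite -mulrA -exprS; exact: cm.
move: t01 => /andP[]; rewrite le_eqVlt => /predU1P[<- _|t0 t1].
  rewrite -/(psi 0) psi0 normr0; apply: le_trans (dpsiA 0 _) => //.
  by rewrite lexx ler01.
have cpsi : {within `[0, t], continuous psi}.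
  by apply: derivable_within_continuous => u _; case: (dpsiE u).
have [z] := MVT t0 (fun u _ => dpsiE u) cpsi.
rewrite psi0 !subr0 in_itv/= => /andP[z0 zt] psiE.
rewrite -/(psi t) psiE normrM.
rewrite -[leRHS]mulr1 ler_pM ?dpsiA//; last by rewrite ger0_norm// ltW.
by rewrite ltW//= ltW// (lt_le_trans zt).
Qed.

End moments.

(** * Oscillation of Sobolev functions *)

Section sobolev.
Context {R : realType}.
Implicit Types (g F : R -> R) (a b c x y p : R).

Lemma periodic_derive1 (F : R -> R) : periodic F 1 -> periodic F^`() 1.
Proof.
move=> pF x; rewrite /derive1.
suff -> : (fun h : R => h^-1 *: (F (h + (x + 1)) - F (x + 1))) =
  (fun h : R => h^-1 *: (F (h + x) - F x)) by [].
by apply/funext => h; rewrite addrA !pF.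
Qed.

Lemma periodic_derive1n F i : periodic F 1 -> periodic F^`(i) 1.
Proof.
by move=> pF; elim: i => [//|i ih]; exact: periodic_derive1 ih.
Qed.

Lemma wint_fin p v a b : 1 <= p -> Lp p v -> a <= b -> wint v a b \is a fin_num.
Proof.
move=> p1 vLp ab; have [pv mv vfin] := vLp.
have p0 : 0 < p by lra.
rewrite ge0_fin_numE ?wint_ge0//; apply: le_lt_trans (wint_holder p v a b p1 mv ab) _.
rewrite lte_mul_pinfty ?lee_fin ?powR_ge0// poweR_lty//.
set G := normpow p v.
have mG : lebfun G by exact: lebfun_powR.
have pG : periodic G 1 by move=> t; rewrite /G /normpow pv.
have G1 : (wint G 0%R 1%R < +oo)%E by rewrite wint_pnorm ?gt_eqF// poweR_lty.
have H n : (wint G a (a + n%:R)%R < +oo)%E.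
  elim: n => [|n ih]; first by rewrite addr0 /wint set_itvE integral_set0 ltry.
  rewrite (wint_cat _ _ (a + n%:R))// ?lerDl ?lerD2l ?ler_nat//.
  have nE : a + n.+1%:R = a + n%:R + 1 by rewrite -addrA natr1.
  by rewrite nE wint_period// lte_add_pinfty.
apply: le_lt_trans (H (Num.bound (b - a))).
apply: wint_le => //; rewrite -lerBlDl; apply/ltW/archi_boundP; lra.
Qed.

(** The estimate on [0, 1] is translated to each [k, k + 1], and an arbitrary
    interval is cut at the integers. *)
Lemma periodic_osc F x y : absolutely_continuous 0 1 F -> periodic F 1 ->
  lebfun F^`() -> x <= y ->
  (`|F y - F x|%:E <= wint F^`() x y)%E.
Proof.
move=> acF pF mF.
have pF' := periodic_derive1 _ pF.
have step k u v : k%:~R <= u -> u <= v -> v <= k%:~R + 1 ->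
    (`|F v - F u|%:E <= wint F^`() u v)%E.
  move=> ku uv vk.
  rewrite -(subrK (k%:~R : R) u) -(subrK (k%:~R : R) v) wint_shiftz// !periodicz//.
  by apply: abs_cont_increment => //; lra.
have [n] : exists n : nat, y <= (Num.floor x)%:~R + n%:R.
  exists (Num.bound `|y - (Num.floor x)%:~R|); rewrite -lerBlDl.
  apply: le_trans (ler_norm _) _; exact/ltW/archi_boundP/normr_ge0.
elim: n x => [|n ih] x.
  rewrite addr0 => yx xy; have /andP[fx _] := Num.Theory.floor_itv x.
  have -> : x = y by apply/le_anti; rewrite xy (le_trans yx).
  by rewrite subrr normr0 wint_ge0.
move=> yn xy; have /andP[fx xf] := Num.Theory.floor_itv x; rewrite intrD in xf.
have [yx|/ltW xz] := leP y ((Num.floor x)%:~R + 1).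
  by apply: (step (Num.floor x)).
set z := _ + 1 in xz xf *.
have zE : z = (Num.floor x + 1)%:~R by rewrite intrD.
have fz : Num.floor z = (Num.floor x + 1)%R by rewrite zE intrKfloor.
rewrite (_ : F y - F x = (F y - F z) + (F z - F x)); last ring.
rewrite (wint_cat _ _ z)//; last exact: ltW.
apply: (@le_trans _ _ (`|F y - F z| + `|F z - F x|)%:E).
  by rewrite lee_fin ler_normD.
rewrite EFinD addeC; apply: leeD.
  by apply: (step (Num.floor x)) => //; exact: ltW.
by apply: ih => //; rewrite fz intrD; move: yn; rewrite -natr1; lra.
Qed.

Lemma sobolev_osc p s g x y : Sobolev p s.+1 g -> x <= y ->
  (`|g^`(s)%classic y - g^`(s)%classic x|%:E <= wint g^`(s.+1) x y)%E.
Proof.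
move=> [pg _ ac [_ mg _]] xy; rewrite derive1nS; apply: periodic_osc => //.
exact: periodic_derive1n.
Qed.

(** A functional that annihilates the polynomials of degree <= s sees only the
    oscillation of the s-th derivative on the window. *)
Lemma functional_bound p s g m (c a : 'I_m -> R) x lo hi : 1 <= p -> Sobolev p s.+1 g ->
  (forall j, (j <= s)%N -> \sum_(i < m) c i * a i ^+ j = 0) ->
  lo <= x <= hi -> (forall i, lo <= x + a i <= hi) ->
  (`|\sum_(i < m) c i * g (x + a i)|%:E <=
   (\sum_(i < m) `|c i| * `|a i| ^+ s)%:E * wint g^`(s.+1) lo hi)%E.
Proof.
move=> p1 gS cm lox loa; have [pg dg ac gLp] := gS.
have lohi : lo <= hi by lra.
have fin : wint g^`(s.+1) lo hi \is a fin_num by exact: (wint_fin p).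
rewrite -(fineK fin) -EFinM lee_fin mulrC.
have := @moment_bound R s m c a g x (fine (wint g^`(s.+1) lo hi)) dg.
have H i t : 0 <= t <= 1 ->
    `|g^`(s)%classic (x + t * a i) - g^`(s)%classic x| <= fine (wint g^`(s.+1) lo hi).
  move=> t01; rewrite -lee_fin fineK//.
  have := loa i => lohia.
  have [z1 z2] : lo <= x + t * a i /\ x + t * a i <= hi.
    by split; nra.
  have [/ltW h|h] := ltP (x + t * a i) x.
    rewrite distrC; apply: le_trans (sobolev_osc _ _ _ _ _ gS h) _.
    by apply: wint_le => //; [case: gLp|lra].
  apply: le_trans (sobolev_osc _ _ _ _ _ gS h) _.
  by apply: wint_le => //; [case: gLp|lra].
move=> /(_ H cm 1); rewrite ler01 lexx => /(_ isT).
by under eq_bigr do rewrite mul1r.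
Qed.

End sobolev.

(** * Finite differences in the p-norm *)

Section pnorm.
Context {R : realType}.
Local Notation mu := (@completed_lebesgue_measure R).
Implicit Types (f g : R -> R) (a b c x p : R).

Lemma lebfun_sum m (f : 'I_m -> R -> R) : (forall i, lebfun (f i)) ->
  lebfun (fun x => \sum_(i < m) f i x).
Proof.
move=> mf; elim: m f mf => [|m ih] f mf.
  rewrite (_ : (fun x => _) = cst 0); first exact: measurable_cst.
  by apply/funext => x; rewrite big_ord0.
rewrite (_ : (fun x => _) = f ord0 \+ (fun x => \sum_(i < m) f (lift ord0 i) x)).
  apply: measurable_funD; first exact: mf.
  by apply: (ih (fun i => f (lift ord0 i))) => i; exact: mf.
by apply/funext => x; rewrite big_ord_recl.
Qed.

Lemma lebfunZ c f : lebfun f -> lebfun (fun x => c * f x).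
Proof. by move=> mf; apply: measurable_funM => //; exact: measurable_cst. Qed.

Lemma pnorm0 p : p != 0 -> pnorm p (fun _ => 0 : R) = 0%E.
Proof.
move=> p0; rewrite /pnorm (_ : _ \o _ = cst 0%E) ?Lnorm0//.
by apply/funext => t /=; rewrite /patch; case: ifP.
Qed.

Lemma eq_pnorm p f g : f =1 g -> pnorm p f = pnorm p g.
Proof. by move=> /funext ->. Qed.

Lemma pnormD p f g : 1 <= p -> lebfun f -> lebfun g ->
  (pnorm p (fun x => f x + g x)%R <= pnorm p f + pnorm p g)%E.
Proof.
move=> p1 mf mg; rewrite /pnorm.
have := minkowski_EFin mu (lebfun_restrict f 0 1 mf) (lebfun_restrict g 0 1 mg) p1.
apply: le_trans; rewrite le_eqVlt; apply/orP; left; apply/eqP; apply: eq_Lnorm => t /=.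
by rewrite /patch; case: ifP => //; rewrite addr0.
Qed.

Lemma pnormZ p c f : 0 < p -> lebfun f ->
  pnorm p (fun x => c * f x) = (`|c|%:E * pnorm p f)%E.
Proof.
move=> p0 mf; have pN0 : p != 0 by rewrite gt_eqF.
rewrite !pnormE// (_ : wint _ _ _ = (`|c| `^ p)%:E * wint (normpow p f) 0%R 1%R)%E.
  rewrite poweRM ?lee_fin ?powR_ge0 ?wint_ge0//; congr (_ * _)%E.
  by rewrite poweR_EFin -powRrM mulfV// powRr1.
rewrite /wint -(ge0_integralZl _ (lebesgue_itv_measurable _)
  (lebfun_norm _ _ (lebfun_powR _ _ mf))).
- apply: eq_integral => t _; rewrite -EFinM /normpow !normrM powRM// normrM.
  by rewrite (ger0_norm (powR_ge0 `|c| _)).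
- by move=> t _; rewrite lee_fin.
- by rewrite lee_fin powR_ge0.
Qed.

Lemma pnorm_shift p f x : 0 < p -> lebfun f -> periodic f 1 ->
  pnorm p (fun t => f (t + x)) = pnorm p f.
Proof.
move=> p0 mf pf; have pN0 : p != 0 by rewrite gt_eqF.
have mG : lebfun (normpow p f) by exact: lebfun_powR.
have pG : periodic (normpow p f) 1 by move=> t; rewrite /normpow pf.
have E := wint_shift (normpow p f) 0 1 x mG.
rewrite add0r addrC (wint_period _ _ mG pG) in E.
by rewrite (pnormE p f pN0) -E (pnormE p _ pN0).
Qed.

Lemma pnorm_sum p m (f : 'I_m -> R -> R) : 1 <= p -> (forall i, lebfun (f i)) ->
  (pnorm p (fun x => \sum_(i < m) f i x)%R <= \sum_(i < m) pnorm p (f i))%E.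
Proof.
move=> p1 mf; elim: m f mf => [|m ih] f mf.
  rewrite big_ord0 (eq_pnorm _ _ (fun _ => 0)) ?pnorm0// ?gt_eqF//; first lra.
  by move=> x; rewrite big_ord0.
rewrite (eq_pnorm _ _ (fun x => f ord0 x + \sum_(i < m) f (lift ord0 i) x)); last first.
  by move=> x; rewrite big_ord_recl.
apply: le_trans (pnormD _ _ _ p1 _ _) _ => //; first exact: lebfun_sum.
rewrite big_ord_recl leeD2l//.
by apply: (ih (fun i => f (lift ord0 i))) => i; exact: mf.
Qed.

Lemma sum_binomial s : \sum_(nu < s.+1) 'C(s, nu)%:R = 2 ^+ s :> R.
Proof.
rewrite (_ : 2 = 1 + 1 :> R)// exprDn.
by apply: eq_bigr => i _; rewrite !expr1n mulr1.
Qed.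

Lemma norm_binomial s nu : `|'C(s, nu)%:R * (-1) ^+ nu| = 'C(s, nu)%:R :> R.
Proof. by rewrite normrM normrX normrN1 expr1n mulr1 normr_nat. Qed.

Lemma lebfun_fdiff s h f : lebfun f -> lebfun (fdiff s h f).
Proof.
move=> mf; apply: (lebfun_sum _ (fun (nu : 'I_s.+1) x => _)) => nu.
by apply: lebfunZ; exact: lebfun_shift.
Qed.

Lemma periodic_fdiff s h f : periodic f 1 -> periodic (fdiff s h f) 1.
Proof.
move=> pf x; apply: eq_bigr => nu _; congr (_ * _).
by rewrite addrAC pf.
Qed.

(** A difference is a combination of translates, with coefficients of total mass
    2 ^+ s. *)
Lemma pnorm_fdiff p s h f : 1 <= p -> lebfun f -> periodic f 1 ->
  (pnorm p (fdiff s h f) <= (2 ^+ s)%:E * pnorm p f)%E.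
Proof.
move=> p1 mf pf; have p0 : 0 < p by lra.
apply: le_trans (pnorm_sum _ _ _ p1 _) _.
  by move=> nu; apply: lebfunZ; exact: lebfun_shift.
rewrite -sum_binomial -sumEFin ge0_sume_distrl; last by move=> i _; rewrite lee_fin.
apply: lee_sum => nu _; rewrite pnormZ ?norm_binomial//; last exact: lebfun_shift.
by rewrite pnorm_shift.
Qed.

Lemma sume_const n (c : \bar R) : (\sum_(j < n) c = n%:R%:E * c)%E.
Proof.
elim: n => [|n ih]; first by rewrite big_ord0 mul0e.
by rewrite big_ord_recr /= ih -(natr1 n) EFinD ge0_muleDl ?lee_fin// mul1e.
Qed.

Lemma wint_subdivide (G : R -> R) u d k : lebfun G -> 0 <= d ->
  wint G u (u + k%:R * d) = (\sum_(i < k) wint G (u + i%:R * d)%R (u + i%:R * d + d)%R)%E.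
Proof.
move=> mG d0; elim: k => [|k ih].
  by rewrite big_ord0 mul0r addr0 /wint set_itvE integral_set0.
have kE : u + k.+1%:R * d = u + k%:R * d + d.
  by rewrite -(natr1 k); ring.
rewrite big_ord_recr /= -ih kE -wint_cat// ?lerDl//.
by rewrite mulr_ge0.
Qed.

(** A window of length s / n consists of s pieces of length 1 / n. For a fixed
    position in the window, the n pieces at that position fill a period. *)
Lemma equispaced_windows (G : R -> R) n s x : (0 < n)%N -> lebfun G -> periodic G 1 ->
  (\sum_(j < n) wint G (x + j%:R * n%:R^-1)%R (x + j%:R * n%:R^-1 + s%:R * n%:R^-1)%R
   <= s%:R%:E * wint G 0%R 1%R)%E.
Proof.
move=> n0 mG pG; have nR : 0 < n%:R :> R by rewrite ltr0n.
under eq_bigr do rewrite wint_subdivide ?invr_ge0//.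
rewrite exchange_big /=.
under eq_bigr.
  move=> i _.
  under eq_bigr do rewrite (addrAC x).
  rewrite -(wint_subdivide G) ?invr_ge0// mulfV ?gt_eqF// wint_period//.
  over.
by rewrite sume_const.
Qed.

(** By periodicity the integral of |f|^p over a period does not change when f is
    translated, so it equals the integral of the mean of |f(x + j / n)|^p over j. *)
Lemma pnorm_le_mean p n f K : (0 < n)%N -> 1 <= p -> lebfun f -> periodic f 1 -> 0 <= K ->
  (forall x, \sum_(j < n) `|f (x + j%:R * n%:R^-1)| `^ p <= n%:R * K `^ p) ->
  (pnorm p f <= K%:E)%E.
Proof.
move=> n0 p1 mf pf K0 fK; have p0 : 0 < p by lra.
have nR : 0 < n%:R :> R by rewrite ltr0n.
set G := normpow p f.
have mG : lebfun G by exact: lebfun_powR.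
have pG : periodic G 1 by move=> t; rewrite /G /normpow pf.
suff H : (n%:R%:E * wint G 0%R 1%R <= n%:R%:E * (K `^ p)%:E)%E.
  rewrite pnormE ?gt_eqF//.
  rewrite (_ : K%:E = poweR (K `^ p)%:E p^-1); last first.
    by rewrite poweR_EFin -powRrM mulfV ?gt_eqF// powRr1.
  apply: gt0_ler_poweR; rewrite ?invr_ge0 ?(ltW p0)//.
  - by rewrite in_itv/= wint_ge0 leey.
  - by rewrite in_itv/= lee_fin powR_ge0 leey.
  - by move: H; rewrite lee_pmul2l// lte_fin.
have -> : (n%:R%:E * wint G 0%R 1%R =
    \sum_(j < n) wint (fun t => G (t + j%:R * n%:R^-1)%R) 0%R 1%R)%E.
  under eq_bigr do rewrite wint_shift// add0r (addrC 1) wint_period//.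
  by rewrite sume_const.
have mGj j : measurable_fun (`[0%R, 1%R[%classic : set (lebesgueType R))
    ((fun t => `|G (t + j%:R * n%:R^-1)%R|%:E) : lebesgueType R -> \bar R).
  by apply: (lebfun_norm (fun t => G (t + j%:R * n%:R^-1))); exact: lebfun_shift.
rewrite /wint -(ge0_integral_sum _ (lebesgue_itv_measurable _) (fun j : 'I_n => mGj j));
  last by move=> j t _; rewrite lee_fin.
apply: (@le_trans _ _ (\int[mu]_(t in `[0%R, 1%R[) (n%:R * K `^ p)%:E)%E).
  apply: (ge0_le_integral _ (lebesgue_itv_measurable _)).
  - by move=> t _; apply: sume_ge0 => j _; rewrite lee_fin.
  - by apply: emeasurable_sum => j; exact: mGj.
  - exact: measurable_cst.
  - move=> t _; rewrite sumEFin lee_fin; apply: le_trans (fK t).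
    by apply: ler_sum => j _; rewrite /G /normpow (ger0_norm (powR_ge0 _ _)).
rewrite integral_cst; last exact: lebesgue_itv_measurable.
by rewrite /= lebesgue_itv_co// subr0 mule1.
Qed.

End pnorm.

(** * Smooth finite differences and separated nodes *)

Section estimates.
Context {R : realType}.
Implicit Types (f g u : R -> R) (a b c x p : R).

Lemma fdiff_pointwise p s g h l x : 1 <= p -> Sobolev p s.+1 g -> 0 < h -> s.+1%:R * h <= l ->
  (`|fdiff s.+1 h g x|%:E <= (2 ^+ s.+1 * l ^+ s)%:E * wint g^`(s.+1)%classic x (x + l)%R)%E.
Proof.
move=> p1 gS h0 hl.
have al (nu : 'I_s.+2) : 0 <= (s.+1 - nu)%:R * h <= l.
  rewrite mulr_ge0 ?(ltW h0)//=; apply: le_trans hl.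
  by rewrite ler_wpM2r ?(ltW h0)// ler_nat leq_subr.
have l0 : 0 <= l by case/andP : (al ord0) => ? ?; lra.
apply: (le_trans (@functional_bound R p s g s.+2
  (fun nu => 'C(s.+1, nu)%:R * (-1) ^+ nu) (fun nu => (s.+1 - nu)%:R * h) x x (x + l) p1 gS _ _ _)).
- move=> j js; rewrite -[RHS](binomial_moment s.+1 j (s.+1%:R * h) (- h))//.
  apply: eq_bigr => nu _; rewrite natrB; last by rewrite -ltnS.
  by congr (_ * _ ^+ _); ring.
- by rewrite lexx lerDl.
- by move=> nu; have := al nu; lra.
apply: lee_wpmul2r; first exact: wint_ge0.
rewrite lee_fin -sum_binomial mulr_suml; apply: ler_sum => nu _.
rewrite norm_binomial ler_wpM2l//; case/andP : (al nu) => a0 a1.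
by apply: lerXn2r; rewrite ?nnegrE// ger0_norm.
Qed.

(** For each x the values at the points x + j / n are controlled by windows of
    length s.+1 / n, each point of the circle lying in s.+1 of them. *)
Lemma fdiff_sobolev p s g n h : 1 <= p -> Sobolev p s.+1 g -> lebfun g ->
  (0 < n)%N -> 0 < h < n%:R^-1 ->
  (pnorm p (fdiff s.+1 h g) <=
    ((2 * s.+1%:R) ^+ s.+1 * n%:R ^- s.+1 * rnorm p g^`(s.+1)%classic)%:E)%E.
Proof.
move=> p1 gS mg n0 /andP[h0 hn]; have [pg _ _ gLp] := gS.
have nR : 0 < n%:R :> R by rewrite ltr0n.
have N0 := rnorm_ge0 p g^`(s.+1)%classic.
have C0 : 0 <= (2 * s.+1%:R) ^+ s.+1 * n%:R ^- s.+1 :> R.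
  by rewrite mulr_ge0 ?exprn_ge0 ?invr_ge0 ?exprn_ge0 ?mulr_ge0.
apply: (pnorm_le_mean _ n) => //.
- exact: lebfun_fdiff.
- exact: periodic_fdiff.
- exact: mulr_ge0.
move=> x; pose l : R := s.+1%:R * n%:R^-1.
have l0 : 0 < l by rewrite mulr_gt0 ?invr_gt0// ltr0n.
have hl : s.+1%:R * h <= l by rewrite ler_wpM2l// ltW.
have B0 : 0 <= 2 ^+ s.+1 * l ^+ s by rewrite mulr_ge0 ?exprn_ge0 ?(ltW l0).
have := @window_sum R p n (fun j => x + j%:R * n%:R^-1)
  (fun j => fdiff s.+1 h g (x + j%:R * n%:R^-1)) g^`(s.+1)%classic l s.+1%:R _ p1 l0 B0 gLp.
move=> /(_ _ _)/le_trans; apply.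
- by move=> G mG pG; exact: equispaced_windows.
- by move=> j; exact: (fdiff_pointwise p).
rewrite (_ : 2 ^+ s.+1 * l ^+ s * l = (2 * s.+1%:R) ^+ s.+1 * n%:R ^- s.+1); last first.
  by rewrite -mulrA -exprSr /l !exprMn exprVn mulrA.
have lE : l^-1 * s.+1%:R = n%:R.
  by rewrite /l invfM invrK mulrAC mulVf ?pnatr_eq0// mul1r.
rewrite (powRM _ C0 N0) -lE le_eqVlt; apply/orP; left; apply/eqP; ring.
Qed.

Lemma separated_windows (G : R -> R) (z : nat -> R) (d : R) m : lebfun G -> 0 <= d ->
  (forall k, (k < m)%N -> z k + d <= z k.+1) ->
  z 0%N <= z m /\
  (\sum_(k < m.+1) wint G (z k) (z k + d)%R <= wint G (z 0%N) (z m + d)%R)%E.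
Proof.
move=> mG d0; elim: m => [|m ih] zd; first by rewrite big_ord1.
have [|z0m zm] := ih; first by move=> k km; apply: zd; exact: ltnW.
have zz := zd m (leqnn _).
split; first lra.
rewrite big_ord_recr /= (wint_cat G (z 0%N) (z m + d)%R)//; [|lra|lra].
by apply: leeD => //; apply: wint_le.
Qed.

Section nodes.
Variables (n : nat) (X : 'I_n -> R) (gamma : R).
Hypothesis n0 : (0 < n)%N.
Hypothesis g01 : 0 < gamma <= 1.
Hypothesis Xsep : forall k, gamma / n%:R <= next_node X k - X k.

Let d := gamma / n%:R.

(** The windows of length d centred at the nodes do not overlap, and all of them
    fit into one period because the separation condition includes the pair
    formed by the last node and the translate of the first one. *)
Lemma node_windows (G : R -> R) : lebfun G -> periodic G 1 ->
  (\sum_(k < n) wint G (X k - d / 2)%R (X k - d / 2 + d)%R <= 1%:E * wint G 0%R 1%R)%E.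
Proof.
rewrite mul1e => mG pG; rewrite /d; move: X n0 Xsep; case: n => // m Y _ Ysep.
set e := gamma / _.
have e0 : 0 <= e by case/andP : g01 => ? _; rewrite divr_ge0 ?ler0n ?(@ltW _ _ 0).
pose z k := Y (inord k) - e / 2.
have [|z0 zsum] := separated_windows G z e m mG e0.
  move=> k km; rewrite /z.
  have := Ysep (inord k); rewrite -/e /next_node inordK ?eqSS ?(ltnW km)//; last exact: ltnW.
  rewrite ltn_eqF// (_ : ordS (inord k) = inord k.+1); first by rewrite addr0 => ?; lra.
  by apply/val_inj; rewrite /= !inordK ?modn_small// ltnW.
have -> : (\sum_(k < m.+1) wint G (Y k - e / 2)%R (Y k - e / 2 + e)%R =
    \sum_(k < m.+1) wint G (z k) (z k + e)%R)%E.
  by apply: eq_bigr => k _; rewrite /z inord_val.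
apply: le_trans zsum _; rewrite -(wint_period G (z 0%N))//.
apply: wint_le => //; rewrite /z.
have := Ysep (inord m); rewrite -/e /next_node inordK// eqxx.
rewrite (_ : ordS (inord m) = inord 0); first by rewrite mulr1n => ?; lra.
by apply/val_inj; rewrite /= !inordK// modnn.
Qed.

(** The number of nodes and the window length are related by n d = gamma, so the
    factor n^-1 d^-1 is gamma^-1, which is at most gamma^-p. *)
Lemma node_norm_le p g (H : R -> R) (B : R) : 1 <= p -> Lp p g -> 0 <= B ->
  (forall k, (`|H (X k)|%:E <= B%:E * wint g (X k - d / 2)%R (X k - d / 2 + d)%R)%E) ->
  discrete_pnorm p X H <= B / n%:R * rnorm p g.
Proof.
move=> p1 gLp B0 HB; have p0 : 0 < p by lra.
have nR : 0 < n%:R :> R by rewrite ltr0n.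
have [ga0 ga1] := andP g01.
have d0 : 0 < d by rewrite divr_gt0.
have N0 := rnorm_ge0 p g.
have := window_sum p n _ (fun k => H (X k)) g d 1 B p1 d0 B0 gLp node_windows HB.
rewrite mul1r => sumH.
have S0 : 0 <= \sum_(k < n) `|H (X k)| `^ p by apply: sumr_ge0 => k _; exact: powR_ge0.
have R0 : 0 <= B / n%:R * rnorm p g by rewrite mulr_ge0 ?divr_ge0.
rewrite /discrete_pnorm (_ : B / n%:R * _ = ((B / n%:R * rnorm p g) `^ p) `^ p^-1); last first.
  by rewrite -powRrM mulfV ?gt_eqF// powRr1.
apply: ge0_ler_powR; rewrite ?nnegrE ?invr_ge0 ?powR_ge0 ?mulr_ge0 ?invr_ge0 ?(ltW p0) ?S0 ?ler0n//.
rewrite ler_pdivrMl//; apply: le_trans sumH _.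
rewrite mulrAC -powRM ?mulr_ge0 ?(ltW d0)//.
have -> : B * d * rnorm p g = gamma * (B / n%:R * rnorm p g) by rewrite /d; field; rewrite gt_eqF.
rewrite (powRM _ (ltW ga0) R0) mulrAC ler_wpM2r ?powR_ge0//.
rewrite /d invf_div mulrCA ler_piMr ?(ltW nR)//.
rewrite ler_pdivrMr// mul1r -[leRHS]powRr1 ?(ltW ga0)//.
  by apply: ger_powR => //; rewrite ga0.
exact: ltW.
Qed.

End nodes.
End estimates.

(** * Steklov averages of p-integrable functions *)

Section steklov.
Context {R : realType}.
Local Notation mu := (@completed_lebesgue_measure R).
Implicit Types (f g u : R -> R) (a b c x p d : R).

Lemma integral_closed g a b : lebfun g -> a <= b ->
  (\int[mu]_(t in `[a, b]) `|g t|%:E = wint g a b)%E.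
Proof.
move=> mg ab; have mb : measurable ([set b] : set (lebesgueType R)).
  by apply: borel_lebesgue; exact: measurable_set1.
rewrite -(setUitv1 true); last by rewrite bnd_simp.
rewrite (ge0_integral_setU _ (lebesgue_itv_measurable _) mb); last 3 first.
- exact: lebfun_norm.
- by move=> t _; rewrite lee_fin.
- by apply/disj_setPLR => t /=; rewrite in_itv/= => /andP[_ tb] tE; rewrite tE ltxx in tb.
rewrite [X in (_ + X)%E](_ : _ = 0%E) ?adde0//.
apply: (null_set_integral mb); first exact: lebfun_norm.
exact: lebesgue_measure_set1.
Qed.

Lemma integrable_closed g a b : lebfun g -> a <= b -> wint g a b \is a fin_num ->
  mu.-integrable `[a, b] (EFin \o g).
Proof.
move=> mg ab gfin; apply/integrableP; split.
  apply/measurable_EFinP; apply: measurable_funS mg => //.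
by rewrite /= integral_closed// ltey_eq gfin.
Qed.

Lemma Rintegral_reflection f d : lebfun f ->
  \int[mu]_(t in `[- d, d]) f (- t) = \int[mu]_(t in `[- d, d]) f t.
Proof.
move=> mf; have N1 : (-1 : R) != 0 by rewrite oppr_eq0 oner_eq0.
have itvN : affine 0 (-1) @^-1` `[- d, d] = `[- d, d] :> set R.
  by apply/seteqP; split => t /=; rewrite !in_itv /affine/=; lra.
rewrite /Rintegral; congr fine; apply/esym; rewrite integralE [RHS]integralE.
have mEf : measurable_fun setT (EFin \o f : lebesgueType R -> \bar R) by exact/measurable_EFinP.
congr (_ - _)%E.
  rewrite (ge0_integral_affine 0 (-1) N1 _ _ (lebesgue_itv_measurable _)
    (measurable_funS measurableT (@subsetT _ _) (measurable_funepos mEf)));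
    last by move=> t _; exact: funepos_ge0.
  rewrite itvN normrN1 mul1e; apply: eq_integral => t _.
  by rewrite !funeposE /affine /= add0r mulN1r.
rewrite (ge0_integral_affine 0 (-1) N1 _ _ (lebesgue_itv_measurable _)
  (measurable_funS measurableT (@subsetT _ _) (measurable_funeneg mEf)));
  last by move=> t _; exact: funeneg_ge0.
rewrite itvN normrN1 mul1e; apply: eq_integral => t _.
by rewrite !funenegE /affine /= add0r mulN1r.
Qed.

(** The integrand of the Steklov average. For a given t its points lie on one side
    of x; symmetrization in t turns it into a central difference. *)
Definition steklov_sum (r : nat) f x (t : R) : R :=
  \sum_(nu < r) (-1) ^+ nu * 'C(2 * r, nu)%:R * f (x + (r - nu)%:R / r%:R * t).

Lemma steklovE r d f x : steklov r d f x =
  (-1) ^+ r.+1 * 'C(2 * r, r)%:R^-1 * (2 / d) *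
  \int[mu]_(t in `[- (d / 2), d / 2]) steklov_sum r f x t.
Proof. by []. Qed.

Lemma steklov_node_gt0 r nu : (nu < r)%N -> 0 < (r - nu)%:R / r%:R :> R.
Proof. by move=> h; rewrite divr_gt0 ?ltr0n ?subn_gt0//; apply: leq_ltn_trans h. Qed.

Lemma steklov_node_le1 r nu : (nu < r)%N -> (r - nu)%:R / r%:R <= 1 :> R.
Proof.
move=> h; rewrite ler_pdivrMr ?mul1r ?ler_nat ?leq_subr// ltr0n.
exact: leq_ltn_trans h.
Qed.

Lemma lebfun_steklov_sum r f x : lebfun f -> lebfun (steklov_sum r f x).
Proof.
move=> mf; apply: (lebfun_sum _ (fun (nu : 'I_r) t => _)) => nu.
by apply: lebfunZ; apply: (lebfun_affine f x _ _ mf); rewrite gt_eqF// steklov_node_gt0.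
Qed.

Lemma sum_binomial_half r : \sum_(nu < r) 'C(2 * r, nu)%:R <= 2 ^+ (2 * r) :> R.
Proof.
rewrite -sum_binomial -(big_mkord xpredT (fun nu => 'C(2 * r, nu)%:R)).
rewrite -[leRHS](big_mkord xpredT (fun nu => 'C(2 * r, nu)%:R)).
rewrite [leRHS](big_cat_nat (n := r))//=; last by lia.
by rewrite lerDl sumr_ge0.
Qed.

(** After the change of variable y = x + c t, with 1 / r <= c <= 1, each term is
    an integral over a part of the window around x, multiplied by 1 / c <= r. *)
Lemma wint_steklov_sum r f x d : (0 < r)%N -> 0 < d -> lebfun f ->
  (wint (steklov_sum r f x) (- (d / 2))%R (d / 2)%R <=
   (2 ^+ (2 * r) * r%:R)%:E * wint f (x - d / 2)%R (x - d / 2 + d)%R)%E.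
Proof.
move=> r0 d0 mf; set W := wint f _ _.
have rR : 0 < r%:R :> R by rewrite ltr0n.
have term (nu : 'I_r) : (wint (f \o affine x ((r - nu)%:R / r%:R))
    (- (d / 2))%R (d / 2)%R <= r%:R%:E * W)%E.
  set c := (r - nu)%:R / r%:R.
  have c0 : 0 < c by exact: steklov_node_gt0.
  have c1 : c <= 1 by exact: steklov_node_le1.
  have rc : 1 <= r%:R * c by rewrite /c mulrC divfK ?gt_eqF// ler1n subn_gt0.
  have := wint_affine f (- (d / 2)) (d / 2) x c mf c0 => cE.
  apply: (@le_trans _ _ ((r%:R * c)%:E * wint (f \o affine x c) (- (d / 2))%R (d / 2)%R)%E).
    by rewrite -[leLHS]mul1e; apply: lee_wpmul2r; rewrite ?wint_ge0 ?lee_fin.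
  rewrite EFinM -muleA -cE; apply: lee_wpmul2l; first by rewrite lee_fin.
  by apply: wint_le => //; nra.
apply: (@le_trans _ _ (\sum_(nu < r) 'C(2 * r, nu)%:R%:E * (r%:R%:E * W))%E); last first.
  rewrite -ge0_sume_distrl; last by move=> i _; rewrite lee_fin.
  rewrite sumEFin EFinM -muleA; apply: lee_wpmul2r.
    by rewrite mule_ge0 ?lee_fin ?wint_ge0.
  by rewrite lee_fin sum_binomial_half.
apply: (@le_trans _ _ (\sum_(nu < r) 'C(2 * r, nu)%:R%:E *
  wint (f \o affine x ((r - nu)%:R / r%:R)) (- (d / 2))%R (d / 2)%R)%E); last first.
  by apply: lee_sum => nu _; apply: lee_wpmul2l; rewrite ?lee_fin.
have mterm (nu : 'I_r) : lebfun (f \o affine x ((r - nu)%:R / r%:R)).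
  by apply: lebfun_affine => //; rewrite gt_eqF// steklov_node_gt0.
have mD := @lebesgue_itv_measurable R (Interval (BLeft (- (d / 2))) (BLeft (d / 2))).
under [leRHS]eq_bigr.
  move=> nu _.
  rewrite /wint -(ge0_integralZl _ mD (lebfun_norm _ _ (mterm nu)) (k := 'C(2 * r, nu)%:R%:E));
    [|by move=> t _; rewrite lee_fin|by rewrite lee_fin].
  over.
have mGnu (nu : 'I_r) : measurable_fun (`[- (d / 2), d / 2[%classic : set (lebesgueType R))
    ((fun t => 'C(2 * r, nu)%:R%:E * `|(f \o affine x ((r - nu)%:R / r%:R)) t|%:E)%E
      : lebesgueType R -> \bar R).
  by apply: measurable_funeM; exact: (lebfun_norm _ _ (mterm nu)).
rewrite /= -(ge0_integral_sum _ mD mGnu);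
  last by move=> nu t _; rewrite mule_ge0 ?lee_fin.
apply: (ge0_le_integral _ mD).
- by move=> t _; rewrite lee_fin.
- by apply: lebfun_norm; exact: lebfun_steklov_sum.
- by apply: emeasurable_sum => nu; exact: mGnu.
- move=> t _; under eq_bigr do rewrite -EFinM.
  rewrite sumEFin lee_fin; apply: le_trans (ler_norm_sum _ _ _) _.
  apply: ler_sum => nu _; rewrite normrM mulrC (mulrC (_ ^+ _)) norm_binomial mulrC.
  exact: lexx.
Qed.

Lemma norm_steklov_coef r d : 0 < d ->
  `|(-1) ^+ r.+1 * 'C(2 * r, r)%:R^-1 * (2 / d)| <= 2 / d :> R.
Proof.
move=> d0; have d20 : 0 <= 2 / d by rewrite divr_ge0// ltW.
rewrite normrM (ger0_norm d20) ler_piMl// normrM normrX normrN1 expr1n mul1r.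
rewrite ger0_norm ?invr_ge0//.
by rewrite invf_le1 ?ltr0n ?ler1n bin_gt0; lia.
Qed.

Lemma integrable_steklov_sum p r f x d : 1 <= p -> (0 < r)%N -> 0 < d -> Lp p f ->
  mu.-integrable `[- (d / 2), d / 2] (EFin \o steklov_sum r f x).
Proof.
move=> p1 r0 d0 fLp; have [_ mf _] := fLp.
apply: integrable_closed; [exact: lebfun_steklov_sum|lra|].
rewrite ge0_fin_numE ?wint_ge0//.
apply: le_lt_trans (wint_steklov_sum _ _ _ _ r0 d0 mf) _.
have fin : wint f (x - d / 2) (x - d / 2 + d) \is a fin_num by apply: (wint_fin p) => //; lra.
by rewrite -(fineK fin) -EFinM ltry.
Qed.

Lemma steklov_le p r f x d : 1 <= p -> (0 < r)%N -> 0 < d -> Lp p f ->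
  (`|steklov r d f x|%:E <=
   (2 / d * (2 ^+ (2 * r) * r%:R))%:E * wint f (x - d / 2)%R (x - d / 2 + d)%R)%E.
Proof.
move=> p1 r0 d0 fLp; have [_ mf _] := fLp.
have iS := integrable_steklov_sum p r f x d p1 r0 d0 fLp.
rewrite steklovE normrM EFinM (EFinM (2 / d)) -muleA.
apply: lee_pmul; rewrite ?lee_fin//; first exact: norm_steklov_coef.
apply: le_trans (wint_steklov_sum _ _ _ _ r0 d0 mf).
rewrite -integral_closed; [|exact: lebfun_steklov_sum|lra].
apply: le_trans (_ : (\int[mu]_(t in `[- (d / 2), d / 2]) `|steklov_sum r f x t|)%:E <= _)%E.
  by rewrite lee_fin; apply: le_normr_Rintegral => //; exact: lebesgue_itv_measurable.
rewrite /Rintegral fineK//.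
have := integrable_abse iS => /integrable_fin_num; apply; exact: lebesgue_itv_measurable.
Qed.

Lemma steklovD p r d f g x : 1 <= p -> (0 < r)%N -> 0 < d -> Lp p f -> Lp p g ->
  steklov r d (fun y => f y + g y) x = steklov r d f x + steklov r d g x.
Proof.
move=> p1 r0 d0 fLp gLp; rewrite !steklovE -mulrDr; congr (_ * _).
rewrite -RintegralD//; last 3 first.
- exact: lebesgue_itv_measurable.
- exact: (integrable_steklov_sum p).
- exact: (integrable_steklov_sum p).
apply: eq_Rintegral => t _; rewrite /steklov_sum -big_split/=.
by apply: eq_bigr => nu _; rewrite mulrDr.
Qed.

End steklov.

(** * Steklov averages of smooth functions *)

Section steklov_smooth.
Context {R : realType}.
Local Notation mu := (@completed_lebesgue_measure R).
Implicit Types (f g u : R -> R) (a b c x p d : R).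

(** The terms at t and at - t are the first r and the last r terms of the central
    difference of order 2 r with step t / r; the middle term is a multiple of
    f x. *)
Lemma steklov_symmetrized r f x t : (0 < r)%N ->
  steklov_sum r f x t + steklov_sum r f x (- t) + (-1) ^+ r * 'C(2 * r, r)%:R * f x =
  \sum_(nu < (2 * r).+1) 'C(2 * r, nu)%:R * (-1) ^+ nu * f (x + (t + - (t / r%:R) * nu%:R)).
Proof.
move=> r0; have rR : r%:R != 0 :> R by rewrite pnatr_eq0 -lt0n.
pose F nu := 'C(2 * r, nu)%:R * (-1) ^+ nu * f (x + (t + - (t / r%:R) * nu%:R)).
rewrite -[RHS](big_mkord xpredT F).
rewrite (big_cat_nat (n := r))//=; last by lia.
rewrite [X in _ = _ + X]big_ltn; last by lia.
have -> : \sum_(0 <= i < r) F i = steklov_sum r f x t.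
  rewrite big_mkord; apply: eq_bigr => nu _; rewrite /F [_ * (-1) ^+ _]mulrC.
  congr (_ * f (_ + _)); rewrite natrB; last exact: ltnW.
  by field.
have -> : F r = (-1) ^+ r * 'C(2 * r, r)%:R * f x.
  by rewrite /F [_ * (-1) ^+ _]mulrC; congr (_ * f _); field.
suff -> : \sum_(r.+1 <= i < (2 * r).+1) F i = steklov_sum r f x (- t) by ring.
(* The last r terms are indexed by nu |-> 2 r - nu. *)
rewrite big_nat_rev/= -{1}(add0n r.+1) big_addn.
rewrite (_ : (2 * r).+1 - r.+1 = r)%N; last by lia.
rewrite big_mkord; apply: eq_bigr => nu _; rewrite /F.
have nur := ltn_ord nu.
rewrite (_ : r.+1 + (2 * r).+1 - (nu + r.+1).+1 = 2 * r - nu)%N; last by lia.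
rewrite bin_sub; last by lia.
have -> : (-1) ^+ (2 * r - nu) = (-1) ^+ nu :> R.
  by rewrite -signr_odd oddB ?mul2n ?odd_double ?signr_odd//; lia.
rewrite [_ * (-1) ^+ _]mulrC; congr (_ * f (_ + _)).
rewrite natrB; last by lia.
rewrite natrB; last by lia.
by rewrite natrM; field.
Qed.

Lemma integrable_reflection f d : lebfun f ->
  mu.-integrable `[- d, d] (EFin \o f) ->
  mu.-integrable `[- d, d] (EFin \o (fun t => f (- t))).
Proof.
move=> mf /integrableP[_ fi]; have N1 : (-1 : R) != 0 by rewrite oppr_eq0 oner_eq0.
have mfN : lebfun (fun t => f (- t)).
  have := lebfun_affine f 0 (-1) N1 mf; congr lebfun.
  by apply/funext => t; rewrite /= /affine add0r mulN1r.
apply/integrableP; split.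
  by apply/measurable_EFinP; apply: measurable_funS mfN.
have itvN : affine 0 (-1) @^-1` `[- d, d] = `[- d, d] :> set R.
  by apply/seteqP; split => t /=; rewrite !in_itv /affine/=; lra.
move: fi; rewrite /= (ge0_integral_affine 0 (-1) N1 _ _
  (lebesgue_itv_measurable _) (lebfun_norm _ _ mf));
  last by move=> t _; rewrite lee_fin.
rewrite itvN normrN1 mul1e; congr (_ < _)%E; apply: eq_integral => t _.
by rewrite /affine add0r mulN1r.
Qed.

(** By symmetry of the interval of integration, the error of the Steklov average
    is, up to sign, the mean over t of the central difference of order
    2 r >= s.+1, divided by its middle coefficient. *)
Lemma steklov_sobolev p r s g x d : 1 <= p -> (0 < r)%N -> (s.+1 <= 2 * r)%N -> 0 < d ->
  Sobolev p s.+1 g -> Lp p g ->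
  (`|steklov r d g x - g x|%:E <=
   (2 ^+ (2 * r) * d ^+ s)%:E * wint g^`(s.+1) (x - d / 2)%R (x - d / 2 + d)%R)%E.
Proof.
move=> p1 r0 sr d0 gS gLp; have [_ mg _] := gLp; have [_ _ _ hLp] := gS.
have rR : 0 < r%:R :> R by rewrite ltr0n.
have fin : wint g^`(s.+1) (x - d / 2) (x - d / 2 + d) \is a fin_num.
  by apply: (wint_fin p) => //; lra.
set w := wint _ _ _ in fin *; pose W := fine w.
have W0 : 0 <= W by rewrite fine_ge0// wint_ge0.
rewrite -(fineK fin) -EFinM lee_fin -/W.
set B := 2 ^+ (2 * r) * d ^+ s.
pose T t := \sum_(nu < (2 * r).+1)
  'C(2 * r, nu)%:R * (-1) ^+ nu * g (x + (t + - (t / r%:R) * nu%:R)).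
have TB t : `[- (d / 2), d / 2]%classic t -> `|T t| <= B * W.
  rewrite /= in_itv/= => /andP[t1 t2].
  have an (nu : 'I_(2 * r).+1) : `|t + - (t / r%:R) * nu%:R| <= d / 2.
    have -> : t + - (t / r%:R) * nu%:R = (1 - nu%:R / r%:R) * t by ring.
    rewrite normrM -[leRHS]mul1r ler_pM// ler_norml; last lra.
    have n2 : nu%:R / r%:R <= 2 :> R.
      by rewrite ler_pdivrMr// -natrM ler_nat -ltnS.
    have n0 : 0 <= nu%:R / r%:R :> R by rewrite divr_ge0.
    lra.
  rewrite -lee_fin EFinM /W fineK//.
  apply: (le_trans (@functional_bound R p s g (2 * r).+1
    (fun nu => 'C(2 * r, nu)%:R * (-1) ^+ nu) (fun nu => t + - (t / r%:R) * nu%:R)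
    x (x - d / 2) (x - d / 2 + d) p1 gS _ _ _)).
  - by move=> j js; apply: binomial_moment; lia.
  - lra.
  - by move=> nu; have := an nu; rewrite ler_norml; lra.
  apply: lee_wpmul2r; first exact: wint_ge0.
  rewrite lee_fin /B -sum_binomial mulr_suml; apply: ler_sum => nu _.
  rewrite norm_binomial ler_wpM2l//; apply: lerXn2r; rewrite ?nnegrE ?(ltW d0)//.
  by apply: le_trans (an nu) _; lra.
pose K := (-1) ^+ r * 'C(2 * r, r)%:R * g x.
pose S := steklov_sum r g x.
have mS : lebfun S by exact: lebfun_steklov_sum.
have iS : mu.-integrable `[- (d / 2), d / 2] (EFin \o S).
  exact: (integrable_steklov_sum p).
have iSN := integrable_reflection S (d / 2) mS iS.
have mI : measurable (`[- (d / 2), d / 2]%classic : set (lebesgueType R)).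
  exact: lebesgue_itv_measurable.
have muI : mu `[- (d / 2), d / 2] = d%:E.
  rewrite -[LHS]/(lebesgue_measure `[- (d / 2), d / 2]) lebesgue_measure_itv/= lte_fin.
  by rewrite ifT; [congr EFin; lra|lra].
have icst c : mu.-integrable `[- (d / 2), d / 2] (EFin \o cst c).
  apply/integrableP; split; first by apply/measurable_EFinP; exact: measurable_cst.
  by rewrite /= integral_cst//= muI -EFinM ltry.
have TE t : T t = S t + S (- t) + K by rewrite /T -steklov_symmetrized.
have iSS : mu.-integrable `[- (d / 2), d / 2] (EFin \o (fun t => S t + S (- t))).
  by have := integrableD mI iS iSN; apply: eq_integrable.
have intT : \int[mu]_(t in `[- (d / 2), d / 2]) T t =
    2 * \int[mu]_(t in `[- (d / 2), d / 2]) S t + d * K.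
  under eq_Rintegral do rewrite TE.
  rewrite RintegralD//; last exact: icst.
  rewrite RintegralD// Rintegral_reflection// Rintegral_cst//.
  by rewrite /= muI /=; ring.
have iT : mu.-integrable `[- (d / 2), d / 2] (EFin \o T).
  have := integrableD mI (integrableD mI iS iSN) (icst K).
  by apply: eq_integrable => // t _; rewrite /= TE.
have normT : `|\int[mu]_(t in `[- (d / 2), d / 2]) T t| <= B * W * d.
  apply: le_trans (le_normr_Rintegral mI iT) _.
  apply: le_trans (_ : \int[mu]_(t in `[- (d / 2), d / 2]) (cst (B * W) t) <= _).
    have iNT := integrable_norm iT.
    exact: (le_Rintegral mI iNT (icst (B * W)) TB).
  by rewrite Rintegral_cst//= muI.
have -> : steklov r d g x - g x = (-1) ^+ r.+1 * 'C(2 * r, r)%:R^-1 * (2 / d) *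
    (2^-1 * \int[mu]_(t in `[- (d / 2), d / 2]) T t).
  rewrite intT steklovE -/S /K exprS.
  have C0 : 'C(2 * r, r)%:R != 0 :> R by rewrite pnatr_eq0 -lt0n bin_gt0 leq_pmull.
  have sq : (-1) ^+ r * (-1) ^+ r = 1 :> R by rewrite -exprD addnn -signr_odd odd_double.
  set sg := (-1) ^+ r in sq *; move: (\int[mu]_(_ in _) _) => IS.
  apply/eqP; rewrite -subr_eq0; apply/eqP.
  transitivity (- g x * (1 - sg * sg)); last by rewrite sq subrr mulr0.
  by field; rewrite C0 gt_eqF.
rewrite normrM; apply: le_trans (ler_pM _ _ (norm_steklov_coef r d d0) (lexx _)) _ => //.
rewrite normrM ger0_norm ?invr_ge0//.
rewrite (_ : 2 / d * (2^-1 * _) = d^-1 * `|\int[mu]_(t in `[- (d / 2), d / 2]) T t|); last first.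
  by field; rewrite gt_eqF.
by rewrite ler_pdivrMl// [leRHS]mulrC.
Qed.

End steklov_smooth.

(** * Discrete norms and closure properties *)

Section discrete.
Context {R : realType}.
Implicit Types (f g : R -> R) (p : R).

(** Expresses the discrete norm as the norm for a sum of Dirac measures, so that
    the Minkowski inequality for integrals applies to it. *)
Lemma Lnorm_dirac_sum n p (a : nat -> R) : p != 0 ->
  Lnorm (msum (fun k : nat => \d_k : {measure set nat -> \bar R}) n) p%:E (EFin \o a) =
  ((\sum_(k < n) `|a k| `^ p) `^ p^-1)%:E.
Proof.
move=> p0; rewrite unlock -poweR_EFin; congr poweR.
rewrite ge0_integral_measure_sum//; last by move=> x _; exact: poweR_ge0.
rewrite -sumEFin; apply: eq_bigr => k _.
rewrite integral_dirac// diracT mul1e. 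
by rewrite -poweR_EFin.
Qed.

Lemma discrete_pnormD p n (X : 'I_n -> R) f g : 1 <= p ->
  discrete_pnorm p X (fun x => f x + g x) <= discrete_pnorm p X f + discrete_pnorm p X g.
Proof.
move=> p1; have p0 : p != 0 by rewrite gt_eqF//; lra.
case: n X => [|n] X; first by rewrite /discrete_pnorm !big_ord0 mulr0 powR0 ?invr_eq0// addr0.
pose a (h : R -> R) (k : nat) := h (X (inord k)).
have dE h : discrete_pnorm p X h =
    (n.+1%:R^-1 `^ p^-1) * (\sum_(k < n.+1) `|a h k| `^ p) `^ p^-1.
  have S0 : 0 <= \sum_(k < n.+1) `|h (X k)| `^ p.
    by apply: sumr_ge0 => k _; exact: powR_ge0.
  have N0 : 0 <= n.+1%:R^-1 :> R by rewrite invr_ge0 ler0n.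
  rewrite /discrete_pnorm (powRM _ N0 S0).
  congr (_ * (_ `^ _)); apply: eq_bigr => k _.
  by rewrite /a inord_val.
rewrite !dE -mulrDr; apply: ler_wpM2l; first exact: powR_ge0.
have := minkowski_EFin (msum (fun k : nat => \d_k : {measure set nat -> \bar R}) n.+1)
  (_ : measurable_fun setT (a f)) (_ : measurable_fun setT (a g)) p1.
by rewrite !(Lnorm_dirac_sum n.+1 p _ p0) -EFinD lee_fin; apply.
Qed.

Lemma discrete_pnorm_sum p n (X : 'I_n -> R) m (f : 'I_m -> R -> R) : 1 <= p ->
  discrete_pnorm p X (fun x => \sum_(i < m) f i x) <= \sum_(i < m) discrete_pnorm p X (f i).
Proof.
move=> p1; have p0 : p != 0 by rewrite gt_eqF//; lra.
elim: m f => [|m ih] f.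
  rewrite big_ord0 /discrete_pnorm big1 ?mulr0 ?powR0 ?invr_eq0// => k _.
  by rewrite big_ord0 normr0 powR0.
rewrite big_ord_recl.
rewrite (_ : (fun x => _) = (fun x => f ord0 x + \sum_(i < m) f (lift ord0 i) x)); last first.
  by apply/funext => x; rewrite big_ord_recl.
by apply: le_trans (discrete_pnormD _ _ _ _ _ p1) _; rewrite lerD2l.
Qed.

Lemma discrete_pnormN p n (X : 'I_n -> R) f :
  discrete_pnorm p X (fun x => - f x) = discrete_pnorm p X f.
Proof. by rewrite /discrete_pnorm; under eq_bigr do rewrite normrN. Qed.

End discrete.

Section Lp_theory.
Context {R : realType}.
Variable p : R.
Hypothesis p1 : 1 <= p.
Implicit Types (f g : R -> R) (c : R).

Let p0 : 0 < p. Proof. exact: lt_le_trans ltr01 p1. Qed.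

Lemma LpD f g : Lp p f -> Lp p g -> Lp p (fun x => f x + g x).
Proof.
move=> [pf mf ff] [pg mg fg]; split.
- by move=> x; rewrite pf pg.
- exact: measurable_funD.
- by apply: le_lt_trans (pnormD _ _ _ p1 mf mg) _; exact: lte_add_pinfty.
Qed.

Lemma LpZ c f : Lp p f -> Lp p (fun x => c * f x).
Proof.
move=> [pf mf ff]; split.
- by move=> x; rewrite pf.
- exact: lebfunZ.
- by rewrite pnormZ// lte_mul_pinfty.
Qed.

Lemma Lp_cst c : Lp p (cst c).
Proof.
split; [by []|exact: measurable_cst|].
rewrite pnormE ?gt_eqF// poweR_lty// /wint.
rewrite (_ : integral _ _ _ =
  integral completed_lebesgue_measure `[0%R, 1%R[ (cst (`|c| `^ p)%:E)); last first.
  by apply: eq_integral => t _; rewrite /normpow /= (ger0_norm (powR_ge0 _ _)).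
rewrite integral_cst; last exact: lebesgue_itv_measurable.
by rewrite /= lebesgue_itv_co// -EFinM ltry.
Qed.

Lemma LpN f : Lp p f -> Lp p (fun x => - f x).
Proof.
by move/(LpZ (-1)); congr Lp; apply/funext => x; rewrite mulN1r.
Qed.

Lemma LpB f g : Lp p f -> Lp p g -> Lp p (f \- g).
Proof. by move=> Lf /LpN Lg; exact: LpD Lf Lg. Qed.

Lemma Lp_sum m (f : 'I_m -> R -> R) : (forall i, Lp p (f i)) ->
  Lp p (fun x => \sum_(i < m) f i x).
Proof.
elim: m f => [|m ih] f Lf.
  rewrite (_ : (fun x => _) = cst 0); first exact: Lp_cst.
  by apply/funext => x; rewrite big_ord0.
rewrite (_ : (fun x => _) = (fun x => f ord0 x + \sum_(i < m) f (lift ord0 i) x)); last first.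
  by apply/funext => x; rewrite big_ord_recl.
apply: LpD; first exact: Lf.
by apply: (ih (fun i => f (lift ord0 i))) => i; exact: Lf.
Qed.

Lemma rnormD f g : Lp p f -> Lp p g ->
  rnorm p (fun x => f x + g x) <= rnorm p f + rnorm p g.
Proof.
move=> Lf Lg; rewrite -lee_fin EFinD.
rewrite -(rnormE _ _ (LpD _ _ Lf Lg)) -(rnormE _ _ Lf) -(rnormE _ _ Lg).
have [[_ mf _] [_ mg _]] := (Lf, Lg).
exact: pnormD.
Qed.

Lemma rnormN f : Lp p f -> rnorm p (fun x => - f x) = rnorm p f.
Proof.
move=> [_ mf _]; rewrite /rnorm -[in RHS](mul1e (pnorm p f)) -(normr1 R) -normrN -pnormZ//.
by congr (fine (pnorm p _)); apply/funext => x; rewrite mulN1r.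
Qed.

Lemma rnorm_sum m (f : 'I_m -> R -> R) : (forall i, Lp p (f i)) ->
  rnorm p (fun x => \sum_(i < m) f i x) <= \sum_(i < m) rnorm p (f i).
Proof.
move=> Lf; rewrite -lee_fin -rnormE; last exact: Lp_sum.
apply: le_trans (pnorm_sum _ _ _ p1 _) _; first by move=> i; case: (Lf i).
by rewrite -sumEFin; apply: lee_sum => i _; rewrite -rnormE.
Qed.

Lemma derive1n_cst c s : (cst c : R -> R)^`(s.+1) = cst 0.
Proof.
elim: s c => [|s ih] c; first by apply/funext => x; rewrite derive1nS derive1n0 derive1_cst.
by rewrite derive1nS ih; apply/funext => x; rewrite derive1_cst.
Qed.

Lemma Sobolev_cst c s : Sobolev p s.+1 (cst c).
Proof.
have E i : exists k, (cst c : R -> R)^`(i) = cst k.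
  by case: i => [|i]; [exists c|exists 0; rewrite derive1n_cst].
split.
- by [].
- by move=> i x _; have [k ->] := E i; exact: derivable_cst.
- move=> e e0; exists 1 => // m u v _ _ _.
  have [k /= ->] := E s.
  by rewrite big1// => i _; rewrite subrr normr0.
- by rewrite derive1n_cst; exact: Lp_cst.
Qed.

End Lp_theory.

(** * Splitting a function into smooth pieces and a remainder *)

Section decomposition.
Context {R : realType}.
Variables (p : R) (r s : nat).
Hypotheses (p1 : 1 <= p) (r0 : (0 < r)%N) (sr : (s.+1 <= 2 * r)%N).
Variables (n : nat) (X : 'I_n -> R) (gamma : R).
Hypotheses (n0 : (0 < n)%N) (g01 : 0 < gamma <= 1).
Hypothesis Xsep : forall k, gamma / n%:R <= next_node X k - X k.
Variable psi : 'I_n -> R -> R.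
Hypothesis Lpsi : forall k, Lp p (psi k).
(** A sampling operator with a fixed number of nodes, detached from the family
    over all n. *)
Definition sample (f : R -> R) (x : R) : R := \sum_(k < n) f (X k) * psi k x.
Variables K2 K3 : R.
Hypothesis K2_gt0 : 0 < K2.
Hypothesis MZ : forall f, Lp p f -> K2 * discrete_pnorm p X f <= rnorm p (sample f).
Hypothesis Jackson : forall f, Sobolev p s.+1 f -> Lp p f ->
  rnorm p (f \- sample f) <= K3 * n%:R ^- s.+1 * rnorm p f^`(s.+1)%classic.

Let nR : 0 < n%:R :> R. Proof. by rewrite ltr0n. Qed.
Let d := gamma / n%:R.
Let d0 : 0 < d. Proof. by case/andP : g01 => ? _; rewrite divr_gt0. Qed.

Lemma Lp_sample f : Lp p (sample f).
Proof. by apply: (Lp_sum p p1) => k; exact: (LpZ p p1 _ _ (Lpsi k)). Qed.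

Variables (m : nat) (w : 'I_m -> R -> R) (u : R -> R).
Hypotheses (Lw : forall i, Lp p (w i)) (Sw : forall i, Sobolev p s.+1 (w i)) (Lu : Lp p u).

Let f x := u x + \sum_(i < m) w i x.
Let sigma i := rnorm p (w i)^`(s.+1)%classic.
Let Sigma := n%:R ^- s.+1 * \sum_(i < m) sigma i.

Let Lf : Lp p f. Proof. exact: (LpD p p1 _ _ Lu (Lp_sum p p1 _ _ Lw)). Qed.

Lemma modulus_decomposition :
  (modulus p s.+1 f n%:R^-1 <=
   (2 ^+ s.+1 * rnorm p u + (2 * s.+1%:R) ^+ s.+1 * Sigma)%:E)%E.
Proof.
apply: ge_ereal_sup => _ [h /= hn <-]; rewrite in_itv/= in hn.
have [pu mu' _] := Lu.
have mw i : lebfun (w i) by case: (Lw i).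
rewrite (eq_pnorm _ _ (fun x => fdiff s.+1 h u x + \sum_(i < m) fdiff s.+1 h (w i) x)); last first.
  move=> x; rewrite /fdiff exchange_big -big_split/=; apply: eq_bigr => nu _.
  by rewrite /f mulrDr mulr_sumr.
apply: le_trans (pnormD _ _ _ p1 _ _) _.
- exact: lebfun_fdiff.
- by apply: (lebfun_sum _ (fun i => fdiff s.+1 h (w i))) => i; exact: lebfun_fdiff.
rewrite EFinD; apply: leeD.
  by rewrite EFinM -rnormE//; exact: pnorm_fdiff.
apply: le_trans (pnorm_sum _ _ _ p1 _) _; first by move=> i; exact: lebfun_fdiff.
rewrite /Sigma mulrA mulr_sumr -sumEFin; apply: lee_sum => i _.
exact: fdiff_sobolev.
Qed.

(** The lower Marcinkiewicz-Zygmund inequality is the only access to the values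
    of u at the nodes, and the smooth pieces enter through the errors of their
    own sampling. *)
Lemma sample_node_bound :
  discrete_pnorm p X u <= K2^-1 * (rnorm p (f \- sample f) + rnorm p u + K3 * Sigma).
Proof.
rewrite ler_pdivlMl//; apply: le_trans (MZ _ Lu) _.
have -> : sample u = (fun x => (- (f \- sample f) x + u x) +
    \sum_(i < m) (w i \- sample (w i)) x).
  apply/funext => x /=; rewrite sumrB.
  have -> : \sum_(i < m) sample (w i) x = sample f x - sample u x.
    rewrite /sample exchange_big -sumrB/=; apply: eq_bigr => k _.
    by rewrite -mulrBl /f -mulr_suml; congr (_ * _); ring.
  by rewrite /f; ring.
have Lfs : Lp p (f \- sample f) by exact: (LpB p p1 _ _ Lf (Lp_sample f)).
have Lws i : Lp p (w i \- sample (w i)) by exact: (LpB p p1 _ _ (Lw i) (Lp_sample _)).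
apply: le_trans (rnormD _ p1 _ _ _ _) _.
- exact: (LpD p p1 _ _ (LpN p p1 _ Lfs) Lu).
- exact: (Lp_sum p p1 _ _ Lws).
apply: lerD.
  apply: le_trans (rnormD p p1 _ _ (LpN p p1 _ Lfs) Lu) _.
  by rewrite (rnormN p p1 _ Lfs).
apply: le_trans (rnorm_sum _ p1 _ _ Lws) _.
rewrite /Sigma mulrA mulr_sumr; apply: ler_sum => i _; exact: Jackson.
Qed.

(** The pieces w_i are compared with their averages. For u the average and the
    nodal values are estimated separately, since u has no smoothness. *)
Lemma steklov_decomposition :
  discrete_pnorm p X (steklov r d f \- f) <=
  2 ^+ (2 * r).+1 * r%:R / gamma * rnorm p u + discrete_pnorm p X u +
  2 ^+ (2 * r) * Sigma.
Proof.
have [ga0 ga1] := andP g01.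
have -> : steklov r d f \- f = (fun x => (steklov r d u x + - u x) +
    \sum_(i < m) (steklov r d (w i) x - w i x)).
  apply/funext => x /=; rewrite sumrB.
  suff -> : steklov r d f x = steklov r d u x + \sum_(i < m) steklov r d (w i) x.
    by rewrite /f; ring.
  rewrite /f (steklovD p r d _ _ x p1 r0 d0 Lu (Lp_sum p p1 _ _ Lw)).
  congr (_ + _); clear -p1 r0 d0 Lw.
  elim: m w Lw => [|k ih] v Lv.
    rewrite big_ord0 steklovE /Rintegral integral0_eq ?mulr0// => t _.
    by rewrite /steklov_sum big1// => nu _; rewrite big_ord0 mulr0.
  have Lv' i : Lp p (v (lift ord0 i)) by exact: Lv.
  rewrite big_ord_recl -(ih _ Lv').
  rewrite -(steklovD p r d _ _ x p1 r0 d0 (Lv ord0) (Lp_sum p p1 _ _ Lv')).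
  by congr steklov; apply/funext => y; rewrite big_ord_recl.
apply: le_trans (discrete_pnormD _ _ _ _ _ p1) _; apply: lerD.
  apply: le_trans (discrete_pnormD _ _ _ _ _ p1) _; apply: lerD; last by rewrite discrete_pnormN.
  pose B := 2 / d * (2 ^+ (2 * r) * r%:R).
  have B0 : 0 <= B.
    apply: mulr_ge0; first by apply: divr_ge0 => //; exact: ltW.
    by apply: mulr_ge0 => //; exact: exprn_ge0.
  apply: le_trans (@node_norm_le R n X gamma n0 g01 Xsep p u _ B p1 Lu B0 _) _.
    by move=> k; exact: (steklov_le p).
  rewrite le_eqVlt; apply/orP; left; apply/eqP; congr (_ * _).
  by rewrite /B /d exprS; field; rewrite !gt_eqF.
apply: le_trans (discrete_pnorm_sum _ _ _ _ _ p1) _.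
rewrite /Sigma mulrA mulr_sumr; apply: ler_sum => i _.
pose B := 2 ^+ (2 * r) * d ^+ s.
have B0 : 0 <= B by apply: mulr_ge0; apply: exprn_ge0 => //; exact: ltW.
have Lwi : Lp p (w i)^`(s.+1)%classic by case: (Sw i).
apply: le_trans (@node_norm_le R n X gamma n0 g01 Xsep p _ _ B p1 Lwi B0 _) _.
  by move=> k; exact: (steklov_sobolev p).
rewrite -/(sigma i) ler_wpM2r ?rnorm_ge0// /B -mulrA ler_wpM2l ?exprn_ge0//.
rewrite exprSr invfM ler_wpM2r ?invr_ge0 ?ler0n// -exprVn.
apply: lerXn2r; rewrite ?nnegrE ?invr_ge0 ?(ltW d0)//.
by rewrite /d ler_pdivrMr// mulVf ?gt_eqF.
Qed.

End decomposition.

(** * The inverse estimate *)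

Theorem theorem4p3 (R : realType) (p : R) (r s : nat)
    (hp : 1 <= p) (hr : (0 < r)%N) (hs : (0 < s)%N) (hsr : (s <= 2 * r)%N)
    (gamma : R) (hgamma : 0 < gamma <= 1)
    (X : forall n : nat, 'I_n -> R) (phi : forall n : nat, 'I_n -> R -> R)
    (hX01 : forall (n : nat) (k : 'I_n), 0 <= X n k < 1)
    (hXlt : forall (n : nat) (i j : 'I_n), (i < j)%N -> X n i < X n j)
    (hXsep : forall (n : nat) (k : 'I_n),
       gamma / n%:R <= next_node (X n) k - X n k)
    (hphi : forall (n : nat) (k : 'I_n), Lp p (phi n k))
    (K1 K2 K3 K4 : R)
    (hK1 : 0 < K1) (hK2 : 0 < K2) (hK3 : 0 < K3) (hK4 : 0 < K4)
    (hMZ : forall (f : R -> R) (n : nat), Lp p f -> (0 < n)%N ->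
       ((K2 * discrete_pnorm p (X n) f)%:E <= pnorm p (sampling X phi n f))%E /\
       (pnorm p (sampling X phi n f) <= (K1 * discrete_pnorm p (X n) f)%:E)%E)
    (hJackson : forall (f : R -> R) (n : nat), Sobolev p s f -> (0 < n)%N ->
       (pnorm p (f \- sampling X phi n f)%R
          <= (K3 * n%:R ^- s)%:E * pnorm p f^`(s))%E)
    (hBernstein : forall (f : R -> R) (nu : nat), Lp p f -> (0 < nu)%N ->
       let g := sampling X phi (2 ^ nu) f \- sampling X phi (2 ^ nu.-1) f in
       Sobolev p s g /\
       (pnorm p g^`(s) <= (K4 * 2 ^+ (s * nu))%:E * pnorm p g)%E) :
  exists2 C : R, 0 < C &
    forall (f : R -> R) (n : nat), Lp p f -> (0 < n)%N ->
      ((discrete_pnorm p (X n) (steklov r (gamma / n%:R) f \- f)%R)%:E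
         + modulus p s f (n%:R^-1)
       <= C%:E *
          (pnorm p (f \- sampling X phi n f)%R
           + (n%:R ^- s)%:E *
             \sum_(0 <= k < (trunc_log 2 n).+1)
               (2 ^+ (s * k))%:E *
               (pnorm p (f \- sampling X phi (2 ^ k) f)%R
                + pnorm p (f \- sampling_half X phi k f)%R)))%E.
Proof.
case: s hs hsr hJackson hBernstein => // s' _ hsr' hJackson' hBernstein'.
pose Cs : R := (2 * s'.+1%:R) ^+ s'.+1.
pose A1 : R := 2 ^+ (2 * r).+1 * r%:R / gamma.
pose a := K2^-1.
pose b := 2 ^+ s'.+1 + A1 + a.
pose c := Cs + 2 ^+ (2 * r) + a * K3.
have [ga0 ga1] := andP hgamma.
have a0 : 0 < a by rewrite invr_gt0.
have A10 : 0 <= A1.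
  by apply: divr_ge0; [apply: mulr_ge0 => //; exact: exprn_ge0|exact: ltW].
have Cs0 : 0 <= Cs by apply: exprn_ge0; exact: mulr_ge0.
have two0 k : 0 <= 2 ^+ k :> R by exact: exprn_ge0.
have b0 : 0 <= b.
  by apply: addr_ge0; [apply: addr_ge0 => //; exact: two0|exact: ltW].
have c0 : 0 <= c.
  by apply: addr_ge0; [apply: addr_ge0 => //; exact: two0|apply: mulr_ge0; exact: ltW].
pose C := a + b * 2 ^+ s'.+1 + c * K4.
have C0 : 0 < C.
  rewrite /C -addrA ltr_pwDl// addr_ge0 ?mulr_ge0//; exact: ltW.
exists C => // f n Lf n0.
have nR : 0 < n%:R :> R by rewrite ltr0n.
set m := trunc_log 2 n.
pose G k := sampling X phi (2 ^ k) f.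
have LS k g : Lp p (sampling X phi k g) by exact: (Lp_sample p hp k (X k) (phi k) (hphi k)).
pose c1 := f (X 1%N ord0).
(* w 0 is the constant c1 = G_1 f (almost everywhere), and w k.+1 is the k-th
   dyadic increment. *)
pose w (i : 'I_m.+1) : R -> R := if (i : nat) is k.+1 then G k.+1 \- G k else cst c1.
pose u x := f x - \sum_(i < m.+1) w i x.
have Lw i : Lp p (w i).
  rewrite /w; case: (i : nat) => [|k]; first exact: (Lp_cst p hp).
  exact: (LpB p hp _ _ (LS _ f) (LS _ f)).
have Sw i : Sobolev p s'.+1 (w i).
  rewrite /w; case: (i : nat) => [|k]; first exact: Sobolev_cst.
  by have [] := hBernstein' f k.+1 Lf isT.
have Lu : Lp p u by exact: (LpB p hp _ _ Lf (Lp_sum p hp _ _ Lw)).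
have fE : f = (fun x => u x + \sum_(i < m.+1) w i x).
  by apply/funext => x; rewrite /u subrK.
have MZ g : Lp p g -> K2 * discrete_pnorm p (X n) g <= rnorm p (sampling X phi n g).
  by move=> Lg; have [+ _] := hMZ g n Lg n0; rewrite (rnormE _ _ (LS n g)) lee_fin.
have Jk k g : (0 < k)%N -> Sobolev p s'.+1 g -> Lp p g -> rnorm p (g \- sampling X phi k g) <=
    K3 * k%:R ^- s'.+1 * rnorm p g^`(s'.+1)%classic.
  move=> k0 Sg Lg; have := hJackson' g k Sg k0.
  rewrite (rnormE _ _ (LpB _ hp _ _ Lg (LS k g))).
  by have [_ _ _ Lgs] := Sg; rewrite (rnormE _ _ Lgs) -EFinM lee_fin.
pose dk k := rnorm p (f \- G k).
pose ek k := rnorm p (f \- sampling_half X phi k f).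
pose S' := n%:R ^- s'.+1 * \sum_(i < m.+1) 2 ^+ (s'.+1 * i) * (dk i + ek i).
have dk0 k : 0 <= dk k by exact: rnorm_ge0.
have ek0 k : 0 <= ek k by exact: rnorm_ge0.
have LdG k : Lp p (f \- G k) by exact: (LpB p hp _ _ Lf (LS _ f)).
have cst_norm0 k : rnorm p (cst k : R -> R)^`(s'.+1)%classic = 0.
  rewrite derive1n_cst /rnorm (eq_pnorm _ _ (fun _ => 0)) ?pnorm0// gt_eqF//.
  exact: lt_le_trans ltr01 hp.
have wsum x : \sum_(i < m.+1) w i x = c1 + (G m x - G 0%N x).
  rewrite big_ord_recl /= -(telescope_sumr (fun k => G k x) (leq0n m)) big_mkord.
  by [].
(* u differs from f - G_{2^m} f by c1 - G_1 f, which vanishes almost everywhere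
   by the Jackson inequality for a constant. *)
have uN : rnorm p u <= dk m.
  have -> : u = (fun x => (f \- G m) x + (- (cst c1 \- sampling X phi 1 (cst c1)) x)).
    apply/funext => x; rewrite /u wsum /G/= /sampling !big_ord1 /c1/=; ring.
  have Lc : Lp p (cst c1 \- sampling X phi 1 (cst c1)).
    by apply: (LpB _ hp); [exact: Lp_cst|exact: LS].
  apply: le_trans (rnormD _ hp _ _ _ (LpN _ hp _ Lc)) _ => //.
  rewrite (rnormN _ hp _ Lc) gerDl.
  have := Jk 1%N _ isT (Sobolev_cst _ hp c1 s') (Lp_cst _ hp c1).
  by rewrite cst_norm0 mulr0.
(* Bernstein inequality, and the triangle inequality through f *)
have sigmaE : n%:R ^- s'.+1 * \sum_(i < m.+1) rnorm p (w i)^`(s'.+1)%classic <= K4 * S'.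
  rewrite /S' mulrCA ler_wpM2l ?invr_ge0 ?exprn_ge0 ?(ltW nR)//.
  rewrite mulr_sumr; apply: ler_sum => i _; rewrite /w.
  case: (i : nat) => [|k].
    by rewrite cst_norm0 !mulr_ge0 ?addr_ge0 ?two0 ?(ltW hK4).
  have [Sg] := hBernstein' f k.+1 Lf isT.
  have [_ _ _ Lgs] := Sg.
  have Lg : Lp p (G k.+1 \- G k) by exact: (LpB p hp _ _ (LS _ f) (LS _ f)).
  rewrite (rnormE _ _ Lgs) (rnormE _ _ Lg) -EFinM lee_fin => /le_trans; apply.
  rewrite -mulrA; apply: ler_wpM2l; first exact: ltW.
  apply: ler_wpM2l; first exact: two0.
  rewrite (_ : G k.+1 \- G k = (fun x => (- (f \- G k.+1) x) + (f \- G k) x)); last first.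
    by apply/funext => x /=; ring.
  apply: le_trans (rnormD _ hp _ _ (LpN _ hp _ (LdG _)) (LdG _)) _.
  by rewrite (rnormN _ hp _ (LdG _)).
(* As n <= 2 ^ m.+1, the last term of the sum alone is at least 2^-s dk m. *)
have dmS : dk m <= 2 ^+ s'.+1 * S'.
  have nm : n%:R <= 2 ^+ m.+1 :> R.
    rewrite -natrX ler_nat ltnW// -/m; exact: trunc_log_ltn.
  rewrite /S' mulrCA ler_pdivlMl ?exprn_gt0//.
  rewrite big_ord_recr /= mulrDr.
  apply: (@le_trans _ _ (2 ^+ s'.+1 * (2 ^+ (s'.+1 * m) * (dk m + ek m)))); last first.
    rewrite lerDr mulr_ge0 ?two0// sumr_ge0// => i _.
    by rewrite mulr_ge0 ?addr_ge0 ?two0.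
  rewrite mulrA -exprD -mulnS mulnC exprM.
  apply: ler_pM; [by apply: exprn_ge0; exact: ltW|exact: dk0| |by rewrite lerDl].
  by apply: lerXn2r; rewrite ?nnegrE ?two0 ?(ltW nR).
have e0 : 0 <= rnorm p (f \- sampling X phi n f) by exact: rnorm_ge0.
have LfS : Lp p (f \- sampling X phi n f) by exact: (LpB p hp _ _ Lf (LS n f)).
have hM := modulus_decomposition p s' hp n n0 m.+1 w u Lw Sw Lu.
have hN := sample_node_bound p s' hp n (X n) (phi n) (hphi n) K2 K3 hK2 MZ
  (fun g => Jk n g n0) m.+1 w u Lw Sw Lu.
have hT := steklov_decomposition p r s' hp hr hsr' n (X n) gamma n0 hgamma (hXsep n)
  m.+1 w u Lw Sw Lu.
rewrite -fE in hM hN hT.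
rewrite big_mkord (rnormE _ _ LfS).
under eq_bigr.
  move=> i _.
  rewrite (rnormE _ _ (LdG i)).
  have Lh : Lp p (f \- sampling_half X phi i f).
    apply: (LpB p hp _ _ Lf); case: (i : nat) => [|k] /=; [exact: Lp_cst|exact: LS].
  rewrite (rnormE _ _ Lh) -EFinD -EFinM.
  over.
rewrite sumEFin -EFinM.
apply: le_trans (leeD (_ : _ <= (A1 * rnorm p u +
  a * (rnorm p (f \- sampling X phi n f) + rnorm p u + K3 * (K4 * S')) +
  2 ^+ (2 * r) * (K4 * S'))%:E)%E hM) _.
  rewrite lee_fin; apply: le_trans hT _; apply: lerD.
    rewrite lerD2l; apply: le_trans hN _.
    by rewrite ler_pM2l// lerD2l ler_pM2l.
  by apply: ler_wpM2l; first exact: two0.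
rewrite -EFinD lee_fin -/S'.
have S0 : 0 <= S'.
  rewrite mulr_ge0 ?invr_ge0 ?exprn_ge0 ?(ltW nR)// sumr_ge0// => i _.
  by rewrite mulr_ge0 ?addr_ge0 ?two0.
set e := rnorm p (f \- sampling X phi n f).
have h1 : Cs * (n%:R ^- s'.+1 * \sum_(i < m.+1) rnorm p (w i)^`(s'.+1)%classic) <= Cs * (K4 * S').
  exact: ler_wpM2l.
have h2 : b * rnorm p u <= b * (2 ^+ s'.+1 * S') by apply: ler_wpM2l => //; exact: le_trans dmS.
have h3 : 0 <= (b * 2 ^+ s'.+1 + c * K4) * e.
  apply: mulr_ge0 => //; apply: addr_ge0; apply: mulr_ge0 => //; exact: ltW.
have h4 : 0 <= a * S' by apply: mulr_ge0 => //; exact: ltW.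
rewrite -/Cs; move: h1 h2 h3 h4; rewrite /C /b /c.
set Z := n%:R ^- s'.+1 * _; set N := rnorm p u; set q := 2 ^+ s'.+1; set q2 := 2 ^+ (2 * r).
move=> h1 h2 h3 h4.
suff -> : (a + (q + A1 + a) * q + (Cs + q2 + a * K3) * K4) * (e + S') =
  (a * e + (q + A1 + a) * (q * S') + Cs * (K4 * S') + q2 * (K4 * S') + a * (K3 * (K4 * S')))
  + ((q + A1 + a) * q + (Cs + q2 + a * K3) * K4) * e + a * S'.
  apply: (@le_trans _ _ (a * e + (q + A1 + a) * N + Cs * Z +
    q2 * (K4 * S') + a * (K3 * (K4 * S')))).
    by rewrite le_eqVlt; apply/orP; left; apply/eqP; ring.
  rewrite -[leLHS]addr0; apply: lerD; last exact: h4.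
  rewrite -[leLHS]addr0; apply: lerD; last exact: h3.
  by do 2 rewrite lerD2r; apply: lerD; [rewrite lerD2l|exact: h1].
ring.
Qed.
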